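(* Let $\tau>0$, let $V:\mathbb{R}^d\times\mathcal{G}\to\mathbb{R}$ be differentiable in $x$, and let $W\in W^{1,2}_{loc}(\mathbb{R}^d)$ with $\int_{\mathbb{R}^d}|x|^2e^{-W}dx<\infty$. Let $\mu\in\mathcal{P}_2(\mathbb{R}^d\times\mathcal{G})$ satisfy $\mathcal{E}(\mu)<\infty$, and let $\mu_\tau\in\mathcal{P}_2(\mathbb{R}^d\times\mathcal{G})$ be a minimizer, with density $f_\tau$ with respect to $dx\,dg$, of $$\sigma\in\mathcal{P}_2(\mathbb{R}^d\times\mathcal{G})\mapsto\mathcal{E}(\sigma)+\mathcal{A}^{\mathcal{G},W,\tau}(\mu,\sigma).$$ Suppose that for some positive constants $\lambda,\Lambda$ the density $f$ of $\mu$ satisfies $$\lambda e^{-V(x,g)}\le f(x,g)\le\Lambda e^{-V(x,g)}\qquad\text{for every }(x,g).$$ Then $f_\tau$ satisfies $$\lambda e^{-V(x,g)}\le f_\tau(x,g)\le\Lambda e^{-V(x,g)}$$ as well.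
   Context: $\mathcal{G}$ is a finite set and $K:\mathcal{G}\times\mathcal{G}\to[0,\infty)$ is symmetric; $(\mathcal{G},K)$ is connected, i.e. any $g,g'$ are joined by a path $g_0=g,\dots,g_m=g'$ with $K(g_l,g_{l+1})>0$. $dg$ is counting measure on $\mathcal{G}$; $\mathcal{P}_2(\mathbb{R}^d\times\mathcal{G})$ is the set of Borel probability measures with finite second moment. Every such $\mu$ is written $\mu=\sum_g\mu_g\otimes\delta_g$ with $\mu_g$ positive measures on $\mathbb{R}^d$. Densities are defined up to null sets, and pointwise inequalities between them are understood accordingly. Relative entropy: $\mathcal{E}(\mu)=\sum_g\int_{\mathbb{R}^d}(f\log f+Vf)(x,g)\,dx$ if $d\mu=f\,dx\,dg$, and $+\infty$ otherwise. Static cost: $ADM(\mu,\sigma)$ is the set of pairs $(\gamma,h)$ where (1) $\gamma=\{\gamma_g\}_{g\in\mathcal{G}}$, each $\gamma_g$ a positive Borel measure on $\mathbb{R}^d\times\mathbb{R}^d$ with first marginal $\pi_{1\#}\gamma_g=\mu_g$; (2) $h=(h_{gg'}(x)):\mathbb{R}^d\times\mathcal{G}\times\mathcal{G}\to\mathbb{R}$ satisfies $h_{gg'}=-h_{g'g}$ and $\sum_{g,g'}\int h_{gg'}^2e^{-W}K(g,g')dx<\infty$; (3) for every $g$, $\sigma_g=\pi_{2\#}\gamma_g-\tau\sum_{g'}h_{gg'}(x)K(g,g')e^{-W(x)}dx$. Set $$C_\tau(\gamma,h)=\sum_g\frac1{2\tau}\int_{\mathbb{R}^d\times\mathbb{R}^d}|x-x'|^2d\gamma_g(x,x')+\frac{\tau}{4}\sum_{g,g'}\int_{\mathbb{R}^d}h_{gg'}^2K(g,g')e^{-W}dx,$$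 and $\mathcal{A}^{\mathcal{G},W,\tau}(\mu,\sigma)=\inf_{ADM(\mu,\sigma)}C_\tau$, with $\inf\emptyset=+\infty$. *)

(* Defs.v *)
From HB Require Import structures.
From mathcomp Require Import all_boot all_order all_algebra.
From mathcomp Require Import all_classical all_reals all_analysis.
From mathcomp Require Import measurable_realfun.

Set Implicit Arguments.
Unset Strict Implicit.
Unset Printing Implicit Defensive.

Import Order.TTheory GRing.Theory Num.Theory.
Import numFieldNormedType.Exports.

Local Open Scope classical_set_scope.
Local Open Scope ring_scope.

(* Borel sigma-algebra of R^n, generated by the open sets. *)
Section borel_rV.
Context (R : realType) (n : nat).
Local Notation borel := (g_sigma_algebraType (@open 'rV[R]_n)).

HB.instance Definition _ := @isMeasurable.Build (sigma_display (@open 'rV[R]_n))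
  'rV[R]_n <<s @open 'rV[R]_n >> (@measurable0 _ borel)
  (@measurableC _ borel) (@bigcupT_measurable _ borel).

End borel_rV.

Lemma measurable_coord (R : realType) n (i : 'I_n) :
  measurable_fun [set: 'rV[R]_n] (fun x : 'rV[R]_n => x 0 i).
Proof.
apply: (measurability _ (RGenOpens.measurableE R)) => _ [_ [a [b ->]] <-].
rewrite setTI; apply: sub_sigma_algebra.
apply: open_comp; last exact: interval_open.
by move=> x _; exact: coord_continuous.
Qed.

Lemma measurable_fun_rV (R : realType) d (T : measurableType d) n
    (f : T -> 'rV[R]_n) :
  (forall i, measurable_fun [set: T] (fun t => f t 0 i)) ->
  measurable_fun [set: T] f.
Proof.
move=> mf; apply: (@measurability _ _ _ _ _ _ (@open 'rV[R]_n)) => // _ [U oU <-].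
rewrite setTI.
pose rV_of (q : 'rV[rat]_n) : 'rV[R]_n := map_mx ratr q.
pose I := ('rV[rat]_n * nat)%type.
pose B (qk : I) : set 'rV[R]_n :=
  if `[< ball (rV_of qk.1) qk.2.+1%:R^-1 `<=` U >]
  then ball (rV_of qk.1) qk.2.+1%:R^-1 else set0.
have -> : U = \bigcup_qk B qk.
  apply/seteqP; split=> [x Ux|x [[q k] _]]; last first.
    by rewrite /B/=; case: asboolP => // qU; exact: qU.
  have /nbhs_ballP[e /= e0 eU] : nbhs x U by apply: open_nbhs_nbhs; split.
  have [k ke] : exists k, k.+1%:R^-1 < e / 2.
    have e2 : 0 < e / 2 by rewrite divr_gt0.
    near \oo => k; exists k; near: k.
    exact: (near_infty_natSinv_lt (PosNum e2)).
  have k0 : (0 : R) < k.+1%:R^-1 by rewrite invr_gt0.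
  have xq i : {r : rat | ball (x 0 i) k.+1%:R^-1 (ratr r)}.
    apply: cid; have [] := @dense_rat R (ball (x 0 i) k.+1%:R^-1).
    - by exists (x 0 i); exact: ballxx.
    - exact: ball_open.
    - by move=> y [? [r _ yE]]; exists r; rewrite yE.
  pose q : 'rV[rat]_n := \row_i sval (xq i).
  have qx : ball (rV_of q) k.+1%:R^-1 x.
    split=> // i j; rewrite (ord1 i) !mxE; apply: ball_sym.
    exact: svalP (xq j).
  exists (q, k) => //; rewrite /B/=; case: asboolP => // -[].
  move=> y qy; apply: eU.
  apply: (@le_ball _ _ _ (k.+1%:R^-1 + k.+1%:R^-1)).
    by rewrite [leRHS](splitr e) lerD ?ltW.
  by apply: ball_triangle qy; exact: ball_sym.
rewrite preimage_bigcup; apply: countable_bigcupT_measurable => [|[q k]]; first exact: countableP.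
rewrite /B/=; case: asboolP => _; last by rewrite preimage_set0.
rewrite (_ : _ @^-1` _ = \bigcap_(i in [set: 'I_n])
    ((fun t => f t 0 i) @^-1` ball (rV_of q 0 i) k.+1%:R^-1)).
  apply: fin_bigcap_measurable => [|i _]; first exact: finite_finset.
  rewrite -[X in measurable X]setTI; apply: mf => //.
  exact: measurable_ball.
apply/seteqP; split=> [t [_ qt] i _|t qt]; first exact: qt.
by split=> [|i j]; rewrite ?invr_gt0// (ord1 i); exact: qt.
Unshelve. all: by end_near. Qed.

Section lebesgue_rV.
Context (R : realType).

Section cons.
Variable n : nat.

Definition rV_cons (p : measurableTypeR R * 'rV[R]_n) : 'rV[R]_n.+1 :=
  row_mx (const_mx p.1 : 'rV_1) p.2.

Lemma measurable_rV_cons : measurable_fun setT rV_cons.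
Proof.
apply: measurable_fun_rV => i; rewrite /rV_cons.
have [j ->|j ->] := split_ordP (i : 'I_(1 + n)).
  apply: eq_measurable_fun measurable_fst => p _.
  by rewrite (row_mxEl _ _ 0 j) mxE.
apply: eq_measurable_fun
  (measurableT_comp (measurable_coord j) measurable_snd) => p _.
by rewrite /= [RHS]row_mxEr.
Qed.

HB.instance Definition _ :=
  isMeasurableFun.Build _ _ _ _ rV_cons measurable_rV_cons.

Local Open Scope ereal_scope.
Variable m : {sigma_finite_measure set 'rV[R]_n -> \bar R}.

Definition lebesgue_step : set 'rV[R]_n.+1 -> \bar R :=
  pushforward (lebesgue_measure \x m) rV_cons.

Let step0 : lebesgue_step set0 = 0.
Proof. by rewrite /lebesgue_step /pushforward preimage_set0 measure0. Qed.

Let step_ge0 A : 0 <= lebesgue_step A.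
Proof. exact: measure_ge0. Qed.

Let step_sigma_additive : semi_sigma_additive lebesgue_step.
Proof.
exact: measure_semi_sigma_additive.
Qed.

HB.instance Definition _ := isMeasure.Build _ _ _
  lebesgue_step step0 step_ge0 step_sigma_additive.

Let step_sigma_finite : sigma_finite setT lebesgue_step.
Proof.
have /sigma_finiteP[E [ET ndE Efin]] :=
  sigma_finiteT (@lebesgue_measure R : {sigma_finite_measure set _ -> \bar R}).
have /sigma_finiteP[F [FT ndF Ffin]] := sigma_finiteT m.
pose tl (v : 'rV[R]_n.+1) : 'rV[R]_n := @rsubmx R 1 1 n v.
have mtl : measurable_fun setT tl.
  apply: measurable_fun_rV => i.
  apply: eq_measurable_fun (measurable_coord (rshift 1 i)) => v _.
  by rewrite /tl mxE.
exists (fun k => (fun v : 'rV[R]_n.+1 => v 0%R 0%R) @^-1` E k `&` tl @^-1` F k).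
  apply/seteqP; split=> // v _.
  have : setT (v 0%R 0%R) by [].
  rewrite ET => -[i _ Ei].
  have : setT (tl v) by [].
  rewrite FT => -[j _ Fj].
  exists (maxn i j) => //; split.
    by have /subsetPset := ndE _ _ (leq_maxl i j); exact.
  by have /subsetPset := ndF _ _ (leq_maxr i j); exact.
move=> k; have [mE Ek] := Efin k; have [mF Fk] := Ffin k; split.
  apply: measurableI; rewrite -[X in measurable X]setTI.
    exact: measurable_coord.
  exact: mtl.
rewrite /lebesgue_step /pushforward.
rewrite (_ : _ @^-1` _ = E k `*` F k).
  by rewrite [ltLHS]product_measure1E// lte_mul_pinfty// ge0_fin_numE.
have hd p : rV_cons p 0%R 0%R = p.1.
  have := @row_mxEl R 1 1 n (const_mx p.1) p.2 ord0 ord0.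
  by rewrite [const_mx _ _ _]mxE => <-; congr (_ _ _); exact: val_inj.
have tlE p : tl (rV_cons p) = p.2 by rewrite /tl /rV_cons row_mxKr.
by apply/seteqP; split=> p /=; rewrite hd tlE.
Qed.

HB.instance Definition _ := Measure_isSigmaFinite.Build _ _ _
  lebesgue_step step_sigma_finite.
End cons.

Fixpoint lebesgue_rV n : {sigma_finite_measure set 'rV[R]_n -> \bar R} :=
  match n return {sigma_finite_measure set 'rV[R]_n -> \bar R} with
  | 0 => dirac (0 : 'rV[R]_0)
  | n'.+1 => lebesgue_step (lebesgue_rV n')
  end.

End lebesgue_rV.

(* [measurableType] has a distinguished point, hence nonempty finite types. *)
#[short(type="finPointedType")]
HB.structure Definition FinPointed := {T of Finite T & isPointed T}.

Definition discrete (T : Type) : Type := T.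

Section discrete.
Variable G : finPointedType.

HB.instance Definition _ := FinPointed.on (discrete G).
HB.instance Definition _ := @isMeasurable.Build default_measure_display
  (discrete G) discrete_measurable discrete_measurable0
  discrete_measurableC discrete_measurableU.

End discrete.

(* Euclidean; the library norm on ['rV_d] is the sup norm. *)
Definition sqnorm (R : realType) d (x : 'rV[R]_d) : R := \sum_i x 0 i ^+ 2.

Section sobolev.
Context (R : realType) (d : nat).
Implicit Types phi w : 'rV[R]_d -> R.

Definition partial (i : 'I_d) phi : 'rV[R]_d -> R :=
  fun x => 'D_(delta_mx 0 i) phi x.

Fixpoint Cn (n : nat) phi : Prop :=
  if n is n'.+1 then
    [/\ continuous phi, forall i x, derivable phi x (delta_mx 0 i)
      & forall i, Cn n' (partial i phi)]
  else continuous phi.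

Definition test_function phi : Prop :=
  (forall n, Cn n phi) /\ compact (closure [set x | phi x != 0]).

Definition L2_loc w : Prop :=
  measurable_fun setT w /\
  forall C : set 'rV[R]_d, compact C ->
    (\int[lebesgue_rV R d]_(x in C) (w x ^+ 2)%:E < +oo)%E.

Definition W12_loc w : Prop :=
  L2_loc w /\
  forall i, exists2 v, L2_loc v &
    forall phi, test_function phi ->
      (\int[lebesgue_rV R d]_x (w x * partial i phi x)%:E =
       - \int[lebesgue_rV R d]_x (v x * phi x)%:E)%E.

End sobolev.

Section measures.
Context (R : realType) (d : nat) (G : finPointedType).
Local Notation X := ('rV[R]_d).
Local Notation dx := (lebesgue_rV R d).
Local Open Scope ereal_scope.

Definition P2 : set (probability (X * discrete G)%type R) :=
  [set mu : probability _ _ | \int[mu]_z (sqnorm z.1)%:E < +oo].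

Implicit Types mu sigma : probability (X * discrete G)%type R.

Definition component mu (g : G) (A : set X) : \bar R :=
  mu (A `*` [set g : discrete G]).

(* [mu = f dx dg]; integration in the counting measure [dg] is the sum over
   [G]. Nonnegativity of [f] almost everywhere follows. *)
Definition is_density mu (f : X -> G -> R) : Prop :=
  (forall g, measurable_fun setT (f ^~ g)) /\
  forall A, measurable A ->
    mu A = \sum_(g : G) \int[dx]_(x in [set x | A (x, g)]) (f x g)%:E.

(* Any two densities of [mu] agree almost everywhere, so the infimum is over at
   most one value, and it is [+oo] when there is no density. *)
Definition entropy (V : X -> G -> R) mu : \bar R :=
  ereal_inf [set \sum_(g : G)
                   \int[dx]_x (f x g * ln (f x g) + V x g * f x g)%:E
            | f in is_density mu].

Section static_cost.
Variables (K : G -> G -> R) (W : X -> R) (tau : R).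
Implicit Types (gam : G -> {measure set (X * X) -> \bar R}).
Implicit Types (h : X -> G -> G -> R).

Definition flux_energy h : \bar R :=
  \sum_(g : G) \sum_(g' : G)
    \int[dx]_x (h x g g' ^+ 2 * K g g' * expR (- W x))%:E.

(* In the last condition the integral is [+oo] or [-oo] when its integrand is
   not integrable, and [A := setT] rules this out since all other terms are
   finite. *)
Definition admissible mu sigma gam h : Prop :=
  [/\ forall g A, measurable A -> gam g (fst @^-1` A) = component mu g A,
      forall g g', measurable_fun setT (fun x => h x g g'),
      forall x g g', h x g g' = (- h x g' g)%R,
      flux_energy h < +oo
    & forall g A, measurable A ->
        component sigma g A = gam g (snd @^-1` A) -
          tau%:E * \int[dx]_(x in A)
            (\sum_(g' : G) h x g g' * K g g' * expR (- W x))%:E].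

Definition cost gam h : \bar R :=
  \sum_(g : G) (2 * tau)^-1%:E * \int[gam g]_z (sqnorm (z.1 - z.2))%:E
  + (tau / 4)%:E * flux_energy h.

Definition static_cost mu sigma : \bar R :=
  ereal_inf [set c | exists gam h, admissible mu sigma gam h /\ c = cost gam h].

End static_cost.

End measures.

(* Main.v *)
Require Import Defs.
From HB Require Import structures.
From mathcomp Require Import all_boot all_order all_algebra.
From mathcomp Require Import all_classical all_reals all_analysis.
From mathcomp Require Import measurable_realfun.
From mathcomp Require Import ring lra.

Set Implicit Arguments.
Unset Strict Implicit.
Unset Printing Implicit Defensive.

Import Order.TTheory GRing.Theory Num.Theory.
Import numFieldNormedType.Exports.

Local Open Scope classical_set_scope.
Local Open Scope ring_scope.

(* A minimizer is compared with competitors obtained by sending back an [e]-fraction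
   of selected particles of an admissible plan [(gam, h)] from [mu] to [mu_tau].  A
   particle moves in [x] along [gam_g], then jumps between the elements of [G] at
   fixed [x] along the flux [h]; cancelling a fraction of its path only decreases the
   cost.  For the upper bound one sends back the particles ending in
   [{f_tau > Lambda e^-V}], for the lower bound those starting in
   [{f_tau < lambda e^-V}].  Since [mu] satisfies the bounds, mass is then moved from
   points where [f_tau e^V] is large to points where it is small, and convexity of
   [v ln v] shows that the entropy decreases by [e c - O(e^2)] with [c > 0]
   independent of the plan.  Hence near-optimal plans suffice: the existence of an
   optimal one is not needed. *)

(** * Pointwise entropy estimates *)

(** At the threshold value [l * expR (- a)] the slope of [ent a] is [ln l + 1], the same at every
    point of space and of [G]. The mass sent back is conserved, so this common slope integrates to
    zero; at first order only the gap between the actual slope and the slope at the threshold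
    survives, and [D] collects it. The obstacle is to say which part of the flux belongs to the
    selected particles: [h] is a net flux, records no trajectories, and may run in cycles at a fixed
    [x]. Perfect mixing at the nodes settles this: each edge carries the proportion [kap] of
    selected mass found at its upstream node. As [kap] is symmetric with values in [0, 1], the
    reduced flux [(1 - e * kap) * h] is again antisymmetric and has no larger energy. *)

Section entropy_tangent.
Variable R : realType.
Implicit Types a b e f l t u v : R.

Definition ent a v := v * ln v + a * v.

Lemma ln_le_sub1 v : 0 < v -> ln v <= v - 1.
Proof.
move=> v0; have := @le_ln1Dx R (v - 1); rewrite [1 + _]addrC subrK.
by apply; lra.
Qed.

Lemma ln_ge_sub1V v : 0 < v -> 1 - v^-1 <= ln v.
Proof.
move=> v0; have := @ln_le_sub1 v^-1; rewrite invr_gt0 => /(_ v0).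
by rewrite lnV ?posrE//; lra.
Qed.

(** Convexity, with the tangent taken at the new value [v], so that the old value [u] may be [0],
    where the slope is unbounded. *)
Lemma ent_tangent a u v : 0 <= u -> 0 < v ->
  ent a v <= ent a u + (ln v + 1 + a) * (v - u).
Proof.
rewrite /ent le_eqVlt => /predU1P[<- v0|u0 v0].
  (* The convention [ln 0 = 0] gives [ent a 0 = 0]. *)
  by rewrite [ln 0]ln0 //; lra.
have := @ln_le_sub1 (v / u); rewrite divr_gt0// => /(_ isT).
rewrite ln_div ?posrE// => /(ler_wpM2l (ltW u0)).
rewrite (_ : u * (v / u - 1) = v - u); last by field; rewrite gt_eqF.
by nra.
Qed.

(** Cruder than the exact minimum [- expR (- a - 1)], but with [a = V] it is integrable as soon as a
    density dominates a multiple of [expR (- V)]. *)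
Lemma ent_ge a v : 0 <= v -> - expR (- a) <= ent a v.
Proof.
rewrite /ent le_eqVlt => /predU1P[<-|v0].
  by rewrite mulr0 mul0r addr0 oppr_le0 expR_ge0.
have := @ln_ge_sub1V (v / expR (- a)); rewrite divr_gt0 ?expR_gt0// => /(_ isT).
rewrite invf_div ln_div ?posrE ?expR_gt0// expRK => /(ler_wpM2l (ltW v0)).
rewrite (_ : v * (1 - _) = v - expR (- a)); last by field; rewrite gt_eqF.
by nra.
Qed.

(* [D] comes from [ln v >= 1 - v^-1] applied to [v = t / (l e^-a)]. *)
Lemma ent_move_above a l e f fr t : 0 <= e <= 2^-1 -> 0 < l ->
  f <= l * expR (- a) -> 0 <= fr <= f -> 0 <= t ->
  let A := l * expR (- a) < t in
  let tr := if A then t else 0 in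
  let D := if A then (t - l * expR (- a)) * (1 - l * expR (- a) / t) else 0 in
  ent a (t + e * (fr - tr)) <=
  ent a t + e * ((ln l + 1) * (fr - tr) + e * (2 * (f + t)) - D).
Proof.
move=> /andP[e0 e2] l0 fE /andP[fr0 frf] t0 /=.
have E0 : 0 < l * expR (- a) by rewrite mulr_gt0 ?expR_gt0.
have lnE : ln (l * expR (- a)) = ln l - a.
  by rewrite lnM ?posrE ?expR_gt0// expRK.
set E := l * expR (- a) in fE E0 lnE *.
(* Below the threshold [E] mass only arrives: the new value is at most [E * (1 + e)], so the slope
   is at most [ln l + 1 + e]. *)
case: ltP => [Et|tE]; last first.
  rewrite !subr0; have [v0|v0] := ltP 0 (t + e * fr).
    apply: le_trans (ent_tangent a t0 v0) _.
    have : ln (t + e * fr) <= ln (E * (1 + e)).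
      by rewrite ler_ln ?posrE//; [nra|apply: mulr_gt0 => //; lra].
    rewrite lnM ?posrE//; last lra.
    have := @ln_le_sub1 (1 + e) ltac:(lra).
    rewrite lnE => h1 h2.
    have : (ln (t + e * fr) + 1 + a) * (e * fr) <= (ln l + e + 1) * (e * fr).
      by apply: ler_wpM2r; [exact: mulr_ge0|lra].
    have := mulr_ge0 (mulr_ge0 e0 e0) fr0.
    have := mulr_ge0 (mulr_ge0 e0 e0) t0.
    have := ler_wpM2l (mulr_ge0 e0 e0) frf.
    by rewrite lerD2l; lra.
  have efr : 0 <= e * fr by exact: mulr_ge0.
  have t00 : t = 0 by lra.
  have efr0 : e * fr = 0 by lra.
  rewrite t00 efr0 addr0 lerDl addr0 mulrDr mulrCA efr0 mulr0 add0r.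
  by rewrite !mulr_ge0//; lra.
(* Above the threshold [fr <= E < t]: the value decreases but stays above [(1 - e) * t], where the
   slope is at least [ln l + 1 + (1 - E / t) - 2 * e]. It multiplies [t - fr >= t - E], which
   produces [D]. *)
have v1 : (1 - e) * t <= t + e * (fr - t) by have := mulr_ge0 e0 fr0; lra.
have v0 : 0 < (1 - e) * t by apply: mulr_gt0; lra.
apply: le_trans (ent_tangent a t0 (lt_le_trans v0 v1)) _.
have : ln ((1 - e) * t) <= ln (t + e * (fr - t)).
  by rewrite ler_ln ?posrE//; exact: lt_le_trans v1.
rewrite lnM ?posrE//; [|lra|lra].
have := @ln_ge_sub1V (1 - e) ltac:(lra).
have : (1 - e)^-1 <= 1 + 2 * e.
  by rewrite -[leLHS]div1r ler_pdivrMr; [nra|lra].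
have := @ln_ge_sub1V (t / E) (divr_gt0 (lt_trans E0 Et) E0).
rewrite invf_div ln_div ?posrE//; last lra.
rewrite lnE => h1 h2 h3 h4.
set k := E / t in h1 *.
have k1 : 0 <= 1 - k by rewrite subr_ge0 ler_pdivrMr; lra.
have hh : ln l + 1 + (1 - k) - 2 * e <= ln (t + e * (fr - t)) + 1 + a by lra.
have etf : 0 <= e * (t - fr) by apply: mulr_ge0; lra.
have := ler_wpM2r etf hh.
have : 0 <= e * ((E - fr) * (1 - k)) by rewrite !mulr_ge0//; lra.
have := mulr_ge0 (mulr_ge0 e0 e0) fr0.
have := ler_wpM2l (mulr_ge0 e0 e0) frf.
by lra.
Qed.

(** Put [E = l * expR (- a)]. On [A] the value rises and must not overshoot: it is at most
    [t + e * f] with [f <= b / l * E], so the slope is at most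
    [ln l + 1 - (1 - t / E) + e * (b / l)]; hence the constant [b / l]. The slope multiplies
    [f - tr >= E - t]. Off [A] mass only leaves, and the slope is at least [ln l + 1 - 2 * e]. *)
Lemma ent_move_below a l b e f tr t : 0 <= e <= 2^-1 -> 0 < l ->
  l * expR (- a) <= f <= b * expR (- a) -> 0 <= tr <= t ->
  let A := t < l * expR (- a) in
  let fr := if A then f else 0 in
  let D := if A then (l * expR (- a) - t) * (1 - t / (l * expR (- a))) else 0 in
  ent a (t + e * (fr - tr)) <=
  ent a t + e * ((ln l + 1) * (fr - tr) + e * ((2 + b / l) * (f + t)) - D).
Proof.
move=> /andP[e0 e2] l0 /andP[fE fb] /andP[tr0 trt] /=.
have E0 : 0 < l * expR (- a) by rewrite mulr_gt0 ?expR_gt0.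
have lnE : ln (l * expR (- a)) = ln l - a.
  by rewrite lnM ?posrE ?expR_gt0// expRK.
have bE : b * expR (- a) = b / l * (l * expR (- a)) by field; rewrite gt_eqF.
rewrite bE in fb; move: (l * expR (- a)) fb fE E0 lnE => E fb fE E0 lnE {bE}.
have c1 : 1 <= b / l by rewrite -(ler_pM2r E0); lra.
move: (b / l) fb c1 => c fb c1.
have t0 : 0 <= t by lra.
have f0 : 0 <= f by lra.
have ee := mulr_ge0 e0 e0.
(* For [e = 0] the new value may be [0], and the tangent inequality needs a positive one. *)
have [->|en0] := eqVneq e 0; first by rewrite !mul0r !addr0.
have {en0} e0' : 0 < e by rewrite lt_neqAle eq_sym en0.
case: ltP => [tE|Et].
  have v0 : 0 < t + e * (f - tr).
    by apply: ltr_wpDl => //; apply: mulr_gt0 => //; lra.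
  apply: le_trans (ent_tangent a t0 v0) _.
  have := @ln_le_sub1 ((t + e * (f - tr)) / E) (divr_gt0 v0 E0).
  rewrite ln_div ?posrE// lnE => h1.
  have h2 : (t + e * (f - tr)) / E <= t / E + e * c.
    rewrite mulrDl lerD2l ler_pdivrMr// -mulrA; apply: ler_wpM2l => //.
    by move: fb; lra.
  set k := t / E in h2 *.
  have k1 : 0 <= 1 - k by rewrite subr_ge0 ler_pdivrMr; lra.
  have hh : ln (t + e * (f - tr)) + 1 + a <= ln l + 1 - (1 - k) + e * c by lra.
  have etf : 0 <= e * (f - tr) by apply: mulr_ge0; lra.
  have := ler_wpM2r etf hh.
  have : 0 <= e * ((f - E + (t - tr)) * (1 - k)) by rewrite !mulr_ge0//; lra.
  have : 0 <= e * e * (2 * (f + t)) by rewrite !mulr_ge0//; lra.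
  have : 0 <= e * e * (c * (t + tr)) by rewrite !mulr_ge0//; lra.
  by lra.
have v1 : (1 - e) * t <= t + e * (0 - tr).
  by have := ler_wpM2l e0 trt; lra.
have v0 : 0 < (1 - e) * t by apply: mulr_gt0; lra.
apply: le_trans (ent_tangent a t0 (lt_le_trans v0 v1)) _.
have : ln ((1 - e) * E) <= ln (t + e * (0 - tr)).
  rewrite ler_ln ?posrE//; [|by apply: mulr_gt0; lra|exact: lt_le_trans v1].
  by apply: le_trans v1; apply: ler_wpM2l; lra.
rewrite lnM ?posrE//; last lra.
have := @ln_ge_sub1V (1 - e) ltac:(lra).
have : (1 - e)^-1 <= 1 + 2 * e.
  by rewrite -[leLHS]div1r ler_pdivrMr; [nra|lra].
rewrite lnE => h1 h2 h3.
have hh : ln l + 1 - 2 * e <= ln (t + e * (0 - tr)) + 1 + a by lra.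
have := ler_wpM2r (mulr_ge0 e0 tr0) hh.
have : 0 <= e * e * (2 * (t - tr) + 2 * f + c * (f + t)).
  by apply: mulr_ge0 => //; rewrite !addr_ge0// !mulr_ge0//; lra.
by lra.
Qed.

End entropy_tangent.

(** * Colouring a finite flow *)

Section network.
Context (R : realType) (G : finType) (s t sr : G -> R) (q : G -> G -> R).

Let inflow g g' := Num.max (q g' g) 0.

(* Node [g] receives the supply [s g], of which [sr g] is coloured, and the inflow
   from its neighbours; it is perfectly mixed.  [coloured k g] is the coloured
   proportion at [g] due to paths of fewer than [k] edges; when nothing passes
   through [g] the division gives [0]. *)
Fixpoint coloured (k : nat) (g : G) : R :=
  if k is k'.+1 then
    (sr g + \sum_g' inflow g g' * coloured k' g') / (s g + \sum_g' inflow g g')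
  else 0.

Hypothesis srs : forall g, 0 <= sr g <= s g.

Let inflow_ge0 g g' : 0 <= inflow g g'.
Proof. by rewrite le_max lexx orbT. Qed.

Let supply_ge0 g : 0 <= s g + \sum_g' inflow g g'.
Proof.
have /andP[sr0 ssr] := srs g.
by rewrite addr_ge0 ?sumr_ge0// (le_trans sr0).
Qed.

Lemma coloured_bounds k g : 0 <= coloured k g <= 1.
Proof.
elim: k g => [|k ih] g /=; first by rewrite lexx ler01.
have /andP[sr0 ssr] := srs g.
have le1 : sr g + \sum_g' inflow g g' * coloured k g' <=
           s g + \sum_g' inflow g g'.
  rewrite lerD// ler_sum// => g' _.
  by rewrite ler_piMr//; case/andP: (ih g').
have ge0 : 0 <= sr g + \sum_g' inflow g g' * coloured k g'.
  rewrite addr_ge0// sumr_ge0// => g' _.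
  by rewrite mulr_ge0//; case/andP: (ih g').
rewrite divr_ge0//=; have := supply_ge0 g; rewrite le_eqVlt => /predU1P[<-|?].
  by rewrite invr0 mulr0.
by rewrite ler_pdivrMr// mul1r.
Qed.

Lemma coloured_nondecreasing g : nondecreasing_seq (coloured ^~ g).
Proof.
apply/nondecreasing_seqP => k; elim: k g => [|k ih] g.
  by case/andP: (coloured_bounds 1 g).
rewrite [leLHS]/= [leRHS]/= ler_wpM2r ?invr_ge0// lerD2l.
by apply: ler_sum => g' _; rewrite ler_wpM2l.
Qed.

(** Least nonnegative solution of the mixing equations. A limit replaces the solution of a linear
    system because a cycle that nothing enters makes the system singular; moreover a limit of
    explicit expressions is measurable in the parameters. *)
Definition colour g := limn (coloured ^~ g).

Lemma cvg_colour g : coloured ^~ g @ \oo --> colour g.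
Proof.
apply: nondecreasing_is_cvgn; first exact: coloured_nondecreasing.
by exists 1 => _ [k _ <-]; case/andP: (coloured_bounds k g).
Qed.

Lemma colour_bounds g : 0 <= colour g <= 1.
Proof.
apply/andP; split.
  apply: limr_ge; first by apply: cvgP; exact: cvg_colour.
  by apply: nearW => k; case/andP: (coloured_bounds k g).
apply: limr_le; first by apply: cvgP; exact: cvg_colour.
by apply: nearW => k; case/andP: (coloured_bounds k g).
Qed.

Lemma colour_balance g :
  colour g * (s g + \sum_g' inflow g g') =
  sr g + \sum_g' inflow g g' * colour g'.
Proof.
have h k : coloured k.+1 g * (s g + \sum_g' inflow g g') =
           sr g + \sum_g' inflow g g' * coloured k g'.
  rewrite [X in X * _]/=.
  (* When nothing passes through [g], the default value of the division is harmless: [sr g] and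
     every inflow vanish, so both sides are [0]. *)
  have [s0|s0] := eqVneq (s g + \sum_g' inflow g g') 0; last by rewrite divfK.
  rewrite s0 mulr0; have /andP[sr0 ssr] := srs g.
  have i0 : 0 <= \sum_g' inflow g g' by apply: sumr_ge0.
  have -> : sr g = 0 by apply/eqP; rewrite eq_le sr0 andbT; lra.
  rewrite big1 ?addr0// => g' _.
  have : \sum_g' inflow g g' == 0 by rewrite eq_le i0 andbT; lra.
  by rewrite psumr_eq0// => /allP/(_ g' (mem_index_enum _))/eqP->; rewrite mul0r.
have h1 : (fun k => coloured k.+1 g * (s g + \sum_g' inflow g g')) @ \oo -->
    colour g * (s g + \sum_g' inflow g g').
  apply: cvgMr_tmp; have := @cvg_colour g.
  by rewrite -(cvg_shiftS (coloured ^~ g)).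
apply: (cvg_unique _ h1) => //.
rewrite (funext h).
apply: cvgD; first exact: cvg_cst.
apply: cvg_big => [|g' _]; first exact: add_continuous.
by apply: cvgMl_tmp; exact: cvg_colour.
Qed.

Hypothesis q_anti : forall g g', q g g' = - q g' g.
Hypothesis balance : forall g, s g - t g = \sum_g' q g g'.

(** An edge carries the colour of its upstream end, in whichever direction the edge is read. *)
Definition split_ratio g g' := if 0 < q g g' then colour g else
  if 0 < q g' g then colour g' else 0.

Lemma split_ratio_bounds g g' : 0 <= split_ratio g g' <= 1.
Proof.
rewrite /split_ratio; case: ifP => _; first exact: colour_bounds.
by case: ifP => _; [exact: colour_bounds|rewrite lexx ler01].
Qed.

Lemma split_ratio_sym g g' : split_ratio g g' = split_ratio g' g.
Proof.
rewrite /split_ratio (q_anti g' g) oppr_gt0.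
by case: (ltgtP (q g g') 0).
Qed.

(** By perfect mixing the exit [t g] and all outgoing edges have the colour of [g], while each
    incoming edge has the colour of its source; [colour_balance] closes the account. *)
Lemma split_balance g :
  sr g - colour g * t g = \sum_g' split_ratio g g' * q g g'.
Proof.
have -> : t g = s g - \sum_g' q g g' by rewrite -balance; lra.
have qE g' : q g g' = inflow g' g - inflow g g'.
  rewrite /inflow (q_anti g' g).
  by rewrite !maxEle oppr_le0; case: (ltgtP (q g g') 0) => q0; lra.
have cE g' : split_ratio g g' * q g g' =
    colour g * inflow g' g - inflow g g' * colour g'.
  rewrite /split_ratio /inflow (q_anti g' g) oppr_gt0.
  by rewrite !maxEle oppr_le0; case: (ltgtP (q g g') 0) => q0; lra.
under [RHS]eq_bigr do rewrite cE.
rewrite sumrB -mulr_sumr.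
under eq_bigr do rewrite qE.
rewrite sumrB.
have := colour_balance g; rewrite mulrDr; lra.
Qed.

End network.

(** On nonnegative reals the inverse is the power [-1], also at [0], where both are [0]. *)
Lemma measurable_fun_inv_ge0 d (T : measurableType d) (R : realType)
    (f : T -> R) : measurable_fun setT f -> (forall x, 0 <= f x) ->
  measurable_fun setT (fun x => (f x)^-1).
Proof.
move=> mf f0; under eq_fun do rewrite -powR_inv1//.
by apply: (measurableT_comp (f := fun x : R => x `^ (-1))) mf; exact: measurable_powR.
Qed.

(** * Flows depending measurably on a parameter *)

Section flow.
Context d (T : measurableType d) (R : realType) (G : finType).
Implicit Types (s t sr tr : T -> G -> R) (q : T -> G -> G -> R).

Lemma measurable_colour s sr q :
  (forall g, measurable_fun setT (s ^~ g)) ->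
  (forall g, measurable_fun setT (sr ^~ g)) ->
  (forall g g', measurable_fun setT (fun x => q x g g')) ->
  (forall x g, 0 <= sr x g <= s x g) ->
  forall g, measurable_fun setT (fun x => colour (s x) (sr x) (q x) g).
Proof.
move=> ms msr mq srs g.
apply: (@measurable_fun_cvg _ _ _ _ (fun k x => coloured (s x) (sr x) (q x) k g));
  last by move=> x _; exact: cvg_colour.
have mmax g1 g2 : measurable_fun setT (fun x => Num.max (q x g1 g2) 0).
  exact: measurable_maxr.
move=> k; elim: k g => [|k ih] g /=; first exact: measurable_cst.
apply: measurable_funM.
  apply: measurable_funD => //; apply: measurable_sum => g'.
  by apply: measurable_funM.
apply: measurable_fun_inv_ge0.
  by apply: measurable_funD => //; apply: measurable_sum => g'.
move=> x; rewrite addr_ge0//.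
  by have /andP[/le_trans sr0 /sr0] := srs x g.
by rewrite sumr_ge0// => g' _; rewrite le_max lexx orbT.
Qed.

(** The colouring is applied separately at each point: [kap] is the coloured share of each edge and
    [tr] the coloured part of the exit [t]. *)
Lemma flow_forward s t sr q :
  (forall g, measurable_fun setT (s ^~ g)) ->
  (forall g, measurable_fun setT (t ^~ g)) ->
  (forall g, measurable_fun setT (sr ^~ g)) ->
  (forall g g', measurable_fun setT (fun x => q x g g')) ->
  (forall x g, 0 <= sr x g <= s x g) ->
  (forall x g, 0 <= t x g) ->
  (forall x g g', q x g g' = - q x g' g) ->
  (forall x g, s x g - t x g = \sum_g' q x g g') ->
  exists (kap : T -> G -> G -> R) (tr : T -> G -> R),
  [/\ forall g g', measurable_fun setT (fun x => kap x g g'),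
      forall g, measurable_fun setT (tr ^~ g),
      forall x g g', 0 <= kap x g g' <= 1 /\ kap x g g' = kap x g' g,
      forall x g, 0 <= tr x g <= t x g &
      forall x g, sr x g - tr x g = \sum_g' kap x g g' * q x g g'].
Proof.
move=> ms mt msr mq srs t0 qN sq.
have mc := measurable_colour ms msr mq srs.
exists (fun x => split_ratio (s x) (sr x) (q x)).
exists (fun x g => colour (s x) (sr x) (q x) g * t x g); split.
- move=> g g'; rewrite /split_ratio.
  apply: measurable_fun_ifT => //; first exact: measurable_fun_ltr.
  by apply: measurable_fun_ifT => //; exact: measurable_fun_ltr.
- by move=> g; exact: measurable_funM.
- move=> x g g'; split; first exact: split_ratio_bounds.
  exact: split_ratio_sym.
- move=> x g; have /andP[c0 c1] := @colour_bounds _ _ _ _ (q x) (srs x) g.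
  by rewrite mulr_ge0//= ler_piMl.
- by move=> x g; exact: split_balance.
Qed.

(** Reversing all edges exchanges supply and exit, so tracing mass back from the exit is the forward
    colouring of the reversed flow. *)
Lemma flow_backward s t tr q :
  (forall g, measurable_fun setT (s ^~ g)) ->
  (forall g, measurable_fun setT (t ^~ g)) ->
  (forall g, measurable_fun setT (tr ^~ g)) ->
  (forall g g', measurable_fun setT (fun x => q x g g')) ->
  (forall x g, 0 <= tr x g <= t x g) ->
  (forall x g, 0 <= s x g) ->
  (forall x g g', q x g g' = - q x g' g) ->
  (forall x g, s x g - t x g = \sum_g' q x g g') ->
  exists (kap : T -> G -> G -> R) (sr : T -> G -> R),
  [/\ forall g g', measurable_fun setT (fun x => kap x g g'),
      forall g, measurable_fun setT (sr ^~ g),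
      forall x g g', 0 <= kap x g g' <= 1 /\ kap x g g' = kap x g' g,
      forall x g, 0 <= sr x g <= s x g &
      forall x g, sr x g - tr x g = \sum_g' kap x g g' * q x g g'].
Proof.
move=> ms mt mtr mq trt s0 qN sq.
have [|||kap [sr [mkap msr kap01 srs E]]] :=
  @flow_forward t s tr (fun x g g' => - q x g g') mt ms mtr _ trt s0.
- by move=> g g'; exact: measurable_funN.
- by move=> x g g'; rewrite (qN x g g').
- by move=> x g; rewrite sumrN -sq opprB.
exists kap, sr; split=> // x g; rewrite -opprB E -sumrN.
by apply: eq_bigr => g' _; rewrite mulrN opprK.
Qed.

End flow.

(** * Measures with a density *)

Section measure_lemmas.
Context d (T : measurableType d) (R : realType).
Local Open Scope ereal_scope.

Lemma ae_le_of_integral (m : {measure set T -> \bar R}) (a b : T -> R) :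
  m.-integrable setT (EFin \o a) -> m.-integrable setT (EFin \o b) ->
  (forall A, measurable A ->
    \int[m]_(x in A) (a x)%:E <= \int[m]_(x in A) (b x)%:E) ->
  {ae m, forall x, (a x <= b x)%R}.
Proof.
move=> ia ib ab.
have ma : measurable_fun setT a by apply/measurable_EFinP/(measurable_int m).
have mb : measurable_fun setT b by apply/measurable_EFinP/(measurable_int m).
pose N := [set x | (b x < a x)%R].
have mN : measurable N.
  have -> : N = (fun x => (b x < a x)%R) @^-1` [set true] by [].
  by rewrite -[X in measurable X]setTI; exact: measurable_fun_ltr.
have iaN : m.-integrable N (EFin \o a) by exact: integrableS ia.
have ibN : m.-integrable N (EFin \o b) by exact: integrableS ib.
have I0 : \int[m]_(x in N) `|((a \- b)%R x)%:E| = 0.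
  apply/eqP; rewrite eq_le integral_ge0// andbT.
  rewrite (eq_integral (fun x => ((a \- b)%R x)%:E)); last first.
    move=> x /set_mem; rewrite /N/= => /ltW ba.
    by rewrite ger0_norm// subr_ge0.
  rewrite integralB_EFin// sube_le0; exact: ab.
have mabN : measurable_fun N (fun x => ((a \- b)%R x)%:E).
  by apply/measurable_EFinP; apply: measurable_funTS; exact: measurable_funB.
have /(ae_eq_integral_abs _ mN mabN) := I0; apply: filterS => x /= h.
rewrite leNgt; apply/negP => ba; have := h ba => -[].
by apply/eqP; rewrite gt_eqF// subr_gt0.
Qed.

Lemma measure_of_density (m : {measure set T -> \bar R}) (w : T -> R) :
  measurable_fun setT w -> (forall x, 0 <= w x)%R ->
  exists nu : {measure set T -> \bar R},
    forall A, nu A = \int[m]_(x in A) (w x)%:E.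
Proof.
move=> mw w0; pose nu A := \int[m]_(x in A) (w x)%:E.
have nu0 : nu set0 = 0 by rewrite /nu integral_set0.
have nuge0 A : 0 <= nu A by apply: integral_ge0 => x _; rewrite lee_fin.
have snu : semi_sigma_additive nu.
  apply: semi_sigma_additive_nng_induced => //; exact/measurable_EFinP.
pose M := isMeasure.Build _ _ _ nu nu0 nuge0 snu.
pose nu' : {measure set T -> \bar R} := HB.pack nu M.
by exists nu'.
Qed.

(** Radon-Nikodym gives the bound by [s] only almost everywhere; the minimum with [s] makes it hold
    at every point, as the pointwise colouring requires. *)
Lemma dominated_density (m : {sigma_finite_measure set T -> \bar R})
    (nu : {measure set T -> \bar R}) (s : T -> R) :
  m.-integrable setT (EFin \o s) -> (forall x, 0 <= s x)%R ->
  (forall A, measurable A -> nu A <= \int[m]_(x in A) (s x)%:E) ->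
  exists r : T -> R, [/\ measurable_fun setT r, forall x, (0 <= r x <= s x)%R &
    forall A, measurable A -> nu A = \int[m]_(x in A) (r x)%:E].
Proof.
move=> si s0 nus.
have ms : measurable_fun setT s by apply/measurable_EFinP/(measurable_int m).
have nufin : fin_num_fun nu.
  move=> A mA; rewrite ge0_fin_numE//; apply: le_lt_trans (nus _ mA) _.
  by apply: integrable_lty => //; exact: integrableS si.
have nuT : nu setT < +oo by rewrite -ge0_fin_numE ?nufin.
(* Restriction to the whole space changes no value; it serves to view [nu] as a finite measure. *)
pose nu' : {finite_measure set T -> \bar R} := mfrestr measurableT nuT.
have nu'E A : nu' A = nu A by transitivity (nu (A `&` setT)); [by []|rewrite setIT].
have dom : nu' `<< m.
  apply/null_content_dominatesP => A mA mA0; apply/eqP.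
  rewrite eq_le measure_ge0 andbT nu'E; apply: le_trans (nus _ mA) _.
  by rewrite null_set_integral//; apply/measurable_EFinP; exact: measurable_funTS.
have [r0 [r0ge0 r0fin r0i nuE]] := radon_nikodym_sigma_finite dom.
pose r1 x := fine (r0 x).
have r1E : r0 = EFin \o r1 by apply/funext => x /=; rewrite fineK.
rewrite {}r1E in r0ge0 r0i nuE.
have mr1 : measurable_fun setT r1 by apply/measurable_EFinP/(measurable_int m).
have aer : {ae m, forall x, (r1 x <= s x)%R}.
  by apply: ae_le_of_integral => // A mA; rewrite -nuE// nu'E; exact: nus.
exists (fun x => Num.min (r1 x) (s x)); split.
- exact: measurable_minr.
- by move=> x; rewrite le_min s0 ge_min lexx orbT -lee_fin r0ge0.
- move=> A mA; rewrite -nu'E nuE//.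
  apply: ge0_ae_eq_integral => //.
  + by apply: measurable_funS (measurable_int m r0i).
  + by apply/measurable_EFinP; apply: measurable_funTS; exact: measurable_minr.
  + by move=> x _; rewrite lee_fin le_min s0 -lee_fin r0ge0.
  + by apply: filterS aer => x rs _ /=; rewrite min_l.
Qed.

End measure_lemmas.

(** * Densities of probability measures on [X * discrete G] *)

Section density_lemmas.
Context (R : realType) (d : nat) (G : finPointedType).
Local Notation X := ('rV[R]_d).
Local Notation dx := (lebesgue_rV R d).
Local Open Scope ereal_scope.
Implicit Types (mu sigma : probability (X * discrete G)%type R).
Implicit Types (f t : X -> G -> R).

Lemma continuous_measurable_rV (f : X -> R) :
  continuous f -> measurable_fun setT f.
Proof.
move=> cf; apply: (measurability _ (RGenOpens.measurableE R)) => _ [_ [a [b ->]] <-].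
rewrite setTI; apply: sub_sigma_algebra.
by apply: open_comp; [move=> x _; exact: cf|exact: interval_open].
Qed.

Lemma measurable_sqnorm : measurable_fun setT (@sqnorm R d).
Proof.
apply: measurable_sum => i; apply: measurable_funX; exact: measurable_coord.
Qed.

Lemma measurable_section (A : set (X * discrete G)) (g : G) :
  measurable A -> measurable [set x | A (x, g)].
Proof.
move=> mA; have := @pair2_measurable _ _ X (discrete G) g measurableT A mA.
by rewrite setTI.
Qed.

Lemma componentE mu f g A : is_density mu f -> measurable A ->
  component mu g A = \int[dx]_(x in A) (f x g)%:E.
Proof.
move=> [mf muE] mA; rewrite /component muE; last first.
  by apply: measurableX => //.
rewrite (bigD1 g)//= big1 ?adde0 => [|g' g'g].
  by congr (integral _ _ _); apply/seteqP; split=> x //= [].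
rewrite (_ : [set x | _] = set0) ?integral_set0//.
by apply/seteqP; split=> x //= [_ gg']; move: g'g; rewrite gg' eqxx.
Qed.

Lemma density_integrable mu f g : is_density mu f ->
  dx.-integrable setT (EFin \o (f ^~ g)).
Proof.
move=> df; have mf := df.1 g; apply/integrableP; split; first exact/measurable_EFinP.
rewrite integral_fin_num_abs// -(componentE g df)//.
apply: fin_num_measure; exact: measurableX.
Qed.

Lemma density_ge0 mu f g : is_density mu f ->
  {ae dx, forall x, (0 <= f x g)%R}.
Proof.
move=> df; apply: (@ae_le_of_integral _ _ _ _ (cst 0%R)).
- exact: integrable0.
- exact: density_integrable df.
- move=> A mA; rewrite integral0 -(componentE g df)//; exact: measure_ge0.
Qed.

Lemma density_unique mu f t g : is_density mu f -> is_density mu t ->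
  {ae dx, forall x, f x g = t x g}.
Proof.
move=> df dt.
have h := density_integrable g.
have := @ae_le_of_integral _ _ _ dx (f ^~ g) (t ^~ g) (h _ _ df) (h _ _ dt).
have := @ae_le_of_integral _ _ _ dx (t ^~ g) (f ^~ g) (h _ _ dt) (h _ _ df).
move=> h1 h2.
have {}h1 : {ae dx, forall x, (t x g <= f x g)%R}.
  by apply: h1 => A mA; rewrite -(componentE g df)// -(componentE g dt).
have {}h2 : {ae dx, forall x, (f x g <= t x g)%R}.
  by apply: h2 => A mA; rewrite -(componentE g df)// -(componentE g dt).
by apply: filterS2 h1 h2 => x tf ft; apply/eqP; rewrite eq_le tf ft.
Qed.

Lemma density_ae mu f t : is_density mu f ->
  (forall g, measurable_fun setT (t ^~ g)) ->
  (forall g, {ae dx, forall x, f x g = t x g}) ->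
  is_density mu t.
Proof.
move=> [mf muE] mt ft; split=> // A mA; rewrite muE//.
apply: eq_bigr => g _; apply: ae_eq_integral.
- exact: measurable_section.
- by apply/measurable_EFinP; exact: measurable_funTS.
- by apply/measurable_EFinP; exact: measurable_funTS.
- by apply: filterS (ft g) => x /= -> _.
Qed.

Lemma density_funrpos mu f : is_density mu f ->
  is_density mu (fun x g => Num.max (f x g) 0%R).
Proof.
move=> df; apply: (density_ae df).
  by move=> g; apply: measurable_maxr => //; exact: df.1.
by move=> g; apply: filterS (density_ge0 g df) => x f0; rewrite max_l.
Qed.

Lemma density_mass mu f : is_density mu f ->
  \sum_g \int[dx]_x (f x g)%:E = 1.
Proof. by move=> df; have := df.2 setT measurableT; rewrite probability_setT => ->. Qed.

Lemma probability_of_density f :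
  (forall g, measurable_fun setT (f ^~ g)) -> (forall x g, 0 <= f x g)%R ->
  \sum_g \int[dx]_x (f x g)%:E = 1 ->
  exists sigma, is_density sigma f.
Proof.
move=> mf f0 f1.
pose nu (A : set (X * discrete G)) :=
  \sum_(g : G) \int[dx]_(x in [set x | A (x, g)]) (f x g)%:E.
have nuge0 A : 0 <= nu A.
  by apply: sume_ge0 => g _; apply: integral_ge0 => x _; rewrite lee_fin.
have nu0 : nu set0 = 0.
  by rewrite /nu big1// => g _; rewrite (_ : [set x | _] = set0) ?integral_set0.
have snu : semi_sigma_additive nu.
  move=> F mF tF mUF; rewrite /nu.
  rewrite (_ : (fun n => _) = fun n => \sum_(g : G) \sum_(0 <= i < n)
     \int[dx]_(x in [set x | F i (x, g)]) (f x g)%:E); last first.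
    by apply/funext => n; rewrite exchange_big.
  apply: cvg_nnesum => g _.
    by apply: nearW => n; apply: sume_ge0 => i _; apply: integral_ge0 => x _;
      rewrite lee_fin.
  rewrite (_ : [set x | _] = \bigcup_n [set x | F n (x, g)]); last first.
    by apply/seteqP; split=> x //= [n].
  apply: (@semi_sigma_additive_nng_induced _ X R dx (fun x => (f x g)%:E)).
  - exact/measurable_EFinP.
  - by move=> x; rewrite lee_fin.
  - by move=> n; exact: measurable_section.
  - by apply/trivIsetP => i j _ _ ij; apply/seteqP; split=> x //= FFx;
      have : (F i `&` F j) (x, g) by []; rewrite ((trivIsetP.1 tF) i j I I ij).
  - rewrite -[X in measurable X]/([set x | (\bigcup_n F n) (x, g)]).
    exact: measurable_section.
pose M := isMeasure.Build _ _ _ nu nu0 nuge0 snu.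
pose nu' : {measure set _ -> \bar R} := HB.pack nu M.
have nuT : nu' setT = 1 by rewrite -f1.
pose P := Measure_isProbability.Build _ _ _ nu' nuT.
pose sigma : probability (X * discrete G)%type R := HB.pack nu M P.
by exists sigma; split.
Qed.

End density_lemmas.

(** [gam'] is [(1 - w) gam] plus the image of [w gam] under [(x, x') -> (x, x)]: a fraction [w] of
    the particles stays at its starting point, at no cost. The second marginals are compared through
    sums because [gam] may be infinite here. *)
Lemma partial_return_plan (R : realType) (d : nat)
    (gam : {measure set ('rV[R]_d * 'rV[R]_d) -> \bar R})
    (w : 'rV[R]_d * 'rV[R]_d -> R) :
  measurable_fun setT w -> (forall z, 0 <= w z <= 1) ->
  exists gam' : {measure set ('rV[R]_d * 'rV[R]_d) -> \bar R},
  [/\ forall A, measurable A -> gam' (fst @^-1` A) = gam (fst @^-1` A),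
      forall A, measurable A ->
        (gam' (snd @^-1` A) + \int[gam]_(z in snd @^-1` A) (w z)%:E =
         gam (snd @^-1` A) + \int[gam]_(z in fst @^-1` A) (w z)%:E)%E &
      (\int[gam']_z (sqnorm (z.1 - z.2))%:E <=
       \int[gam]_z (sqnorm (z.1 - z.2))%:E)%E].
Proof.
move=> mw w01.
have mw' : measurable_fun setT (fun z => 1 - w z) by exact: measurable_funB.
have w0 z : 0 <= w z by case/andP: (w01 z).
have w'0 z : 0 <= 1 - w z by rewrite subr_ge0; case/andP: (w01 z).
have [g1 g1E] := measure_of_density gam mw' w'0.
have [g2 g2E] := measure_of_density gam mw w0.
pose phi (z : 'rV[R]_d * 'rV[R]_d) := (z.1, z.1).
have mphi : measurable_fun setT phi by exact: measurable_fun_pair.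
unshelve epose (g3 := (pushforward g2 phi :
  {measure set ('rV[R]_d * 'rV[R]_d) -> \bar R})); first exact: mphi.
have g3E A : g3 A = g2 (phi @^-1` A) by [].
have mfst A : measurable A -> measurable ((fst : 'rV[R]_d * 'rV[R]_d -> _) @^-1` A).
  by move=> mA; rewrite -[X in measurable X]setTI; exact: measurable_fst.
have msnd A : measurable A -> measurable ((snd : 'rV[R]_d * 'rV[R]_d -> _) @^-1` A).
  by move=> mA; rewrite -[X in measurable X]setTI; exact: measurable_snd.
have g12 A : measurable A -> (g1 A + g2 A = gam A)%E.
  move=> mA; rewrite g1E g2E -ge0_integralD//;
    do ?[by move=> z _; rewrite lee_fin
        |by apply/measurable_EFinP; exact: measurable_funTS].
  rewrite (eq_integral (cst 1%E)) ?integral_cst ?mul1e//.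
  by move=> z _; rewrite /= -EFinD subrK.
exists (measure_add g1 g3); split.
- by move=> A mA; rewrite [LHS]measure_addE g3E -g12//; exact: mfst.
- move=> A mA; rewrite [X in (X + _)%E]measure_addE g3E -g12; last exact: msnd.
  by rewrite -!g2E addeAC.
have msq : measurable_fun setT
    (fun z : 'rV[R]_d * 'rV[R]_d => (sqnorm (z.1 - z.2))%:E).
  apply/measurable_EFinP; apply: measurable_sum => i; apply: measurable_funX.
  under eq_fun do rewrite !mxE.
  apply: measurable_funB.
    exact: measurableT_comp (measurable_coord i) measurable_fst.
  exact: measurableT_comp (measurable_coord i) measurable_snd.
have sq0 (z : 'rV[R]_d * 'rV[R]_d) : (0 <= (sqnorm (z.1 - z.2))%:E)%E.
  by rewrite lee_fin sumr_ge0// => i _; exact: sqr_ge0.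
rewrite ge0_integral_measure_add//.
have -> : (\int[g3]_z (sqnorm (z.1 - z.2))%:E = 0)%E.
  rewrite (ge0_integral_pushforward mphi)//.
  rewrite integral0_eq// => z _ /=; rewrite subrr /sqnorm big1// => i _.
  by rewrite mxE expr0n.
rewrite adde0; apply: ge0_le_measure_integral => // A mA.
by rewrite -g12// leeDl.
Qed.
(** [s] carries no pointwise sign, so the formula passes through the Radon-Nikodym derivative of
    [nu], which agrees with [s] almost everywhere. *)
Lemma integral_of_density d (T : measurableType d) (R : realType)
    (m : {sigma_finite_measure set T -> \bar R})
    (nu : {measure set T -> \bar R}) (s w : T -> R) (B : set T) :
  m.-integrable setT (EFin \o s) ->
  (forall A, measurable A -> nu A = \int[m]_(x in A) (s x)%:E)%E ->
  measurable_fun setT w -> (forall x, 0 <= w x) -> measurable B ->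
  (\int[nu]_(x in B) (w x)%:E = \int[m]_(x in B) (w x * s x)%:E)%E.
Proof.
move=> si nuE mw w0 mB.
have ms : measurable_fun setT s by apply/measurable_EFinP/(measurable_int m).
have nuT : (nu setT < +oo)%E.
  by rewrite nuE//; exact: integrable_lty.
pose nu' : {finite_measure set T -> \bar R} := mfrestr measurableT nuT.
have nu'E A : nu' A = nu A by transitivity (nu (A `&` setT)); [by []|rewrite setIT].
have dom : nu' `<< m.
  apply/null_content_dominatesP => A mA mA0; rewrite nu'E nuE//.
  by rewrite null_set_integral//; apply/measurable_EFinP; exact: measurable_funTS.
transitivity (\int[nu']_(x in B) (w x)%:E)%E.
  by apply: eq_measure_integral => A mA _; rewrite -nu'E.
rewrite -(Radon_Nikodym_SigmaFinite.change_of_variables dom)//; last first.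
  by apply/measurable_EFinP; exact: measurable_funTS.
have rni := Radon_Nikodym_SigmaFinite.f_integrable dom.
have rns : ae_eq m setT (Radon_Nikodym_SigmaFinite.f nu' m) (EFin \o s).
  apply: integral_ae_eq => //; first exact/measurable_EFinP.
  by move=> E _ mE; rewrite -Radon_Nikodym_SigmaFinite.f_integral// -nuE//; exact: nu'E.
apply: ae_eq_integral => //.
- apply: emeasurable_funM; first by apply/measurable_EFinP; exact: measurable_funTS.
  by apply: measurable_funTS; exact: measurable_int rni.
- by apply/measurable_EFinP; apply: measurable_funTS; exact: measurable_funM.
- by apply: filterS rns => x /= rs _; rewrite rs// EFinM.
Qed.

Section marginals.
Context d d' (Z : measurableType d) (T : measurableType d') (R : realType).
Variables (m : {sigma_finite_measure set T -> \bar R})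
  (gam : {measure set Z -> \bar R}) (p : Z -> T) (s : T -> R).
Hypotheses (mp : measurable_fun setT p) (si : m.-integrable setT (EFin \o s))
  (sE : forall A, measurable A ->
    (gam (p @^-1` A) = \int[m]_(x in A) (s x)%:E)%E).
Local Open Scope ereal_scope.

Lemma integral_marginal (w : T -> R) (B : set T) :
  measurable_fun setT w -> (forall x, 0 <= w x)%R -> measurable B ->
  \int[gam]_(z in p @^-1` B) (w (p z))%:E = \int[m]_(x in B) (w x * s x)%:E.
Proof.
move=> mw w0 mB.
unshelve epose (nu := (pushforward gam p : {measure set T -> \bar R})).
  exact: mp.
rewrite -(@integral_of_density _ _ _ m nu)//.
rewrite (ge0_integral_pushforward mp)//.
  by apply/measurable_EFinP; exact: measurable_funTS.
by move=> x _; rewrite lee_fin.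
Qed.

(** Weights at most [1] select part of the particles, whose image under [p] is dominated by the
    image of all of them. *)
Lemma dominated_marginal (w : Z -> R) : measurable_fun setT w ->
  (forall z, 0 <= w z <= 1)%R -> (forall x, 0 <= s x)%R ->
  exists r : T -> R, [/\ measurable_fun setT r, forall x, (0 <= r x <= s x)%R &
    forall A, measurable A ->
      \int[gam]_(z in p @^-1` A) (w z)%:E = \int[m]_(x in A) (r x)%:E].
Proof.
move=> mw w01 s0.
have [g1 g1E] := measure_of_density gam mw (fun z => proj1 (andP (w01 z))).
unshelve epose (nu := (pushforward g1 p : {measure set T -> \bar R})).
  exact: mp.
have nuE A : nu A = \int[gam]_(z in p @^-1` A) (w z)%:E by rewrite -g1E.
have [A mA|r [mr rs rE]] := dominated_density (nu := nu) si s0.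
  rewrite nuE -sE//.
  have mpA : measurable (p @^-1` A) by rewrite -[X in measurable X]setTI; exact: mp.
  rewrite -[leRHS]mul1e -[leRHS]integral_cst//; apply: ge0_le_integral => //.
  - by move=> z _; rewrite lee_fin; case/andP: (w01 z).
  - by apply/measurable_EFinP; exact: measurable_funTS.
  - by move=> z _; rewrite lee_fin; case/andP: (w01 z).
by exists r; split=> // A mA; rewrite -nuE rE.
Qed.

End marginals.

(** * Sending back part of an admissible plan *)

Section competitor.
Context (R : realType) (d : nat) (G : finPointedType).
Local Notation X := ('rV[R]_d).
Local Notation dx := (lebesgue_rV R d).
Local Open Scope ereal_scope.
Variables (K : G -> G -> R) (W : X -> R) (tau : R).
Hypotheses (K_ge0 : forall g g', (0 <= K g g')%R)
  (K_sym : forall g g', K g g' = K g' g) (tau_gt0 : (0 < tau)%R)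
  (mW : measurable_fun setT W).
Variables (mu mu_tau : probability (X * discrete G)%type R)
  (f t : X -> G -> R).
Hypotheses (mu_P2 : P2 mu) (mu_tau_P2 : P2 mu_tau).
Hypotheses (f_ge0 : forall x g, (0 <= f x g)%R)
  (t_ge0 : forall x g, (0 <= t x g)%R).
Hypotheses (f_density : is_density mu f) (t_density : is_density mu_tau t).
Variables (gam : G -> {measure set (X * X) -> \bar R}) (h : X -> G -> G -> R).
Hypothesis adm : admissible K W tau mu mu_tau gam h.

(** Density in [x] of the net mass jumping from [g] to [g']. With [tau] included, the last
    admissibility condition becomes a flow balance at each [x]. *)
Definition jump (k : X -> G -> G -> R) x g g' : R :=
  (tau * (k x g g' * K g g' * expR (- W x)))%R.

Let mf g : measurable_fun setT (f ^~ g). Proof. exact: f_density.1. Qed.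
Let mt g : measurable_fun setT (t ^~ g). Proof. exact: t_density.1. Qed.
Let mh g g' : measurable_fun setT (fun x => h x g g').
Proof. by case: adm. Qed.

Lemma measurable_jump k g g' : measurable_fun setT (fun x => k x g g') ->
  measurable_fun setT (fun x => jump k x g g').
Proof.
move=> mk; apply: measurable_funM => //; apply: measurable_funM.
  exact: measurable_funM.
by apply: measurableT_comp => //; exact: measurable_funN.
Qed.

Lemma jump_anti x g g' : jump h x g g' = (- jump h x g' g)%R.
Proof.
have [_ _ hN _ _] := adm.
by rewrite /jump (hN x g g') (K_sym g g') !mulNr mulrN.
Qed.

(** Density of the particles after their move in [x] and before their jumps, as [second_marginal]
    confirms. *)
Let inter x g := (t x g + \sum_(g' : G) jump h x g g')%R.

Lemma gam_finite g A : measurable A -> gam g A \is a fin_num.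
Proof.
move=> mA; rewrite ge0_fin_numE//.
apply: (@le_lt_trans _ _ (gam g setT)); first by rewrite le_measure ?inE.
have [+ _ _ _ _] := adm => /(_ g setT measurableT).
rewrite preimage_setT => ->; rewrite (componentE g f_density)//.
by apply: integrable_lty => //; exact: density_integrable f_density.
Qed.

(** On the whole space the last admissibility condition relates the integral of the jumps to two
    finite masses, so it is finite; a finite integral in the extended reals forces integrability. *)
Lemma jump_integrable g :
  dx.-integrable setT (EFin \o (fun x => \sum_(g' : G) jump h x g g')%R).
Proof.
have mQ : measurable_fun setT
    (fun x => \sum_(g' : G) h x g g' * K g g' * expR (- W x))%R.
  apply: measurable_sum => g'; apply: measurable_funM.
    exact: measurable_funM.
  by apply: measurableT_comp => //; exact: measurable_funN.
have iQ : dx.-integrable setT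
    (EFin \o (fun x => \sum_(g' : G) h x g g' * K g g' * expR (- W x))%R).
  apply/integrableP; split; first exact/measurable_EFinP.
  rewrite integral_fin_num_abs//.
  have [_ _ _ _ /(_ g setT measurableT)] := adm.
  rewrite preimage_setT; have := gam_finite g measurableT.
  have : component mu_tau g setT \is a fin_num.
    by apply: fin_num_measure; exact: measurableX.
  case: (component _ _ _) => // a _; case: (gam _ _) => // b _.
  by case: (\int[_]_x _) => //=; rewrite ?(gt0_muley,gt0_muleNy) ?lte_fin.
rewrite (_ : EFin \o _ = fun x => tau%:E *
    (\sum_(g' : G) h x g g' * K g g' * expR (- W x))%:E).
  exact: integrableZl.
by apply/funext => x /=; rewrite -EFinM mulr_sumr.
Qed.

Lemma inter_integrable g : dx.-integrable setT (EFin \o (inter ^~ g)).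
Proof.
have := integrableD measurableT (density_integrable g t_density) (jump_integrable g).
by apply: eq_integrable => // x _; rewrite /= -EFinD.
Qed.

Lemma integral_jump k g A : measurable A ->
  (forall g', measurable_fun setT (fun x => k x g g')) ->
  dx.-integrable setT (EFin \o (fun x => \sum_(g' : G) jump k x g g')%R) ->
  tau%:E * \int[dx]_(x in A) (\sum_(g' : G) k x g g' * K g g' * expR (- W x))%:E
  = \int[dx]_(x in A) (\sum_(g' : G) jump k x g g')%:E.
Proof.
move=> mA mk ik; rewrite -integralZl//; last first.
  have := integrableZl measurableT tau^-1 ik => /(integrableS measurableT mA (@subsetT _ _)).
  apply: eq_integrable => // x _; rewrite /= -EFinM; congr EFin.
  by rewrite -mulr_sumr mulKf// gt_eqF.
by apply: eq_integral => x _; rewrite -EFinM mulr_sumr.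
Qed.

Lemma second_marginal g A : measurable A ->
  gam g (snd @^-1` A) = \int[dx]_(x in A) (inter x g)%:E.
Proof.
move=> mA; have [_ _ _ _ /(_ g A mA)] := adm.
rewrite integral_jump//; last exact: jump_integrable.
have iJ := integrableS measurableT mA (@subsetT _ _) (jump_integrable g).
have it := integrableS measurableT mA (@subsetT _ _) (density_integrable g t_density).
rewrite (componentE g t_density)// => E.
rewrite (eq_integral (fun x => (t x g)%:E + (\sum_(g' : G) jump h x g g')%:E)); last first.
  by move=> x _; rewrite EFinD.
rewrite integralD//= E subeK//; exact: integrable_fin_num.
Qed.


(** * Competitors from a selection of particles *)

Section transfer.
Variables (w : G -> X * X -> R) (fr sr tr : X -> G -> R) (kap : X -> G -> G -> R).
Hypotheses (mw : forall g, measurable_fun setT (w g))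
  (w01 : forall g z, (0 <= w g z <= 1)%R)
  (mfr : forall g, measurable_fun setT (fr ^~ g))
  (msr : forall g, measurable_fun setT (sr ^~ g))
  (mtr : forall g, measurable_fun setT (tr ^~ g))
  (mkap : forall g g', measurable_fun setT (fun x => kap x g g'))
  (frf : forall x g, (0 <= fr x g <= f x g)%R)
  (sr0 : forall x g, (0 <= sr x g)%R)
  (trt : forall x g, (0 <= tr x g <= t x g)%R)
  (kap01 : forall x g g', (0 <= kap x g g' <= 1)%R /\ kap x g g' = kap x g' g)
  (frE : forall g A, measurable A ->
    \int[gam g]_(z in fst @^-1` A) (w g z)%:E = \int[dx]_(x in A) (fr x g)%:E)
  (srE : forall g A, measurable A ->
    \int[gam g]_(z in snd @^-1` A) (w g z)%:E = \int[dx]_(x in A) (sr x g)%:E)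
  (sr_tr : forall g, {ae dx, forall x,
    (sr x g - tr x g = \sum_(g' : G) kap x g g' * jump h x g g')%R}).

(** [kap] is symmetric and [jump h] antisymmetric, so the coloured jumps cancel in the sum over [G]
    at almost every point. *)
Lemma transfer_mass :
  \sum_g \int[dx]_x (fr x g)%:E = \sum_g \int[dx]_x (tr x g)%:E.
Proof.
transitivity (\sum_g \int[dx]_x (sr x g)%:E).
  by apply: eq_bigr => g _; rewrite -frE// -srE// !preimage_setT.
rewrite -!ge0_integral_sum//;
  do ?[by move=> g; exact/measurable_EFinP
      |by move=> g x _; rewrite lee_fin; case/andP: (trt x g)].
apply: ae_eq_integral => //.
- by apply: emeasurable_sum => g; exact/measurable_EFinP.
- by apply: emeasurable_sum => g; exact/measurable_EFinP.
apply: filterS (filter_forall _ sr_tr) => x /= srtr _.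
rewrite !sumEFin; congr EFin; apply/eqP.
rewrite -subr_eq0 -sumrB; under eq_bigr do rewrite srtr.
set S := (X in X == _).
suff : S = (- S)%R by move=> SN; apply/eqP; lra.
rewrite {1}/S exchange_big /S -sumrN; apply: eq_bigr => g _.
rewrite -sumrN; apply: eq_bigr => g' _.
by rewrite -(kap01 x g g').2 (jump_anti x g' g) mulrN.
Qed.

Variable e : R.
Hypothesis e01 : (0 <= e <= 1)%R.

(** The plan sends back the fraction [e * w] of [gam] and reduces the flux to [(1 - e * kap) * h].
    The density before the jumps changes by [e * (fr - sr)] and the net outflow by
    [- e * (sr - tr)], which leaves [e * (fr - tr)] for the end density. *)
Lemma transfer_competitor : exists sigma,
  [/\ P2 sigma, is_density sigma (fun x g => t x g + e * (fr x g - tr x g))%R &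
      static_cost K W tau mu sigma <= cost K W tau gam h].
Proof.
have /andP[e0 e1] := e01.
have ibetween (a b : X -> R) : measurable_fun setT a ->
    (forall x, 0 <= a x <= b x)%R -> dx.-integrable setT (EFin \o b) ->
    dx.-integrable setT (EFin \o a).
  move=> ma ab; apply: le_integrable => //; first exact/measurable_EFinP.
  move=> x _ /=; have /andP[a0 ax] := ab x.
  by rewrite lee_fin !ger0_norm// (le_trans a0).
have it g := density_integrable g t_density.
have iJ g := jump_integrable g.
have ifr g : dx.-integrable setT (EFin \o (fr ^~ g)).
  exact: ibetween (density_integrable g f_density).
have itr g : dx.-integrable setT (EFin \o (tr ^~ g)) by exact: ibetween (it g).
have isr g : dx.-integrable setT (EFin \o (sr ^~ g)).
  apply/integrableP; split; first exact/measurable_EFinP.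
  rewrite integral_fin_num_abs// -srE// ge0_fin_numE; last first.
    by apply: integral_ge0 => z _; rewrite lee_fin; case/andP: (w01 g z).
  apply: (@le_lt_trans _ _ (gam g setT)).
    rewrite preimage_setT -[leRHS]mul1e -[leRHS]integral_cst//.
    apply: ge0_le_integral => //.
    - by move=> z _; rewrite lee_fin; case/andP: (w01 g z).
    - exact/measurable_EFinP.
    - by move=> z _; rewrite lee_fin; case/andP: (w01 g z).
  by rewrite ltey_eq gam_finite.
have fin g A (F : X -> G -> R) : measurable A ->
    dx.-integrable setT (EFin \o (F ^~ g)) ->
    \int[dx]_(x in A) (F x g)%:E \is a fin_num.
  by move=> mA /(integrableS measurableT mA (@subsetT _ _))/(integrable_fin_num mA).
pose F x g := (t x g + e * (fr x g - tr x g))%R.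
have F0 x g : (0 <= F x g)%R.
  have /andP[tr0 trt'] := trt x g; have /andP[fr0 _] := frf x g.
  have : (e * tr x g <= t x g)%R by rewrite (le_trans _ trt')// ler_piMl.
  by have := mulr_ge0 e0 fr0; rewrite /F; lra.
have mF g : measurable_fun setT (F ^~ g).
  by apply: measurable_funD => //; apply: measurable_funM => //; exact: measurable_funB.
have FE g A : measurable A ->
    \int[dx]_(x in A) (F x g)%:E + e%:E * \int[dx]_(x in A) (tr x g)%:E =
    \int[dx]_(x in A) (t x g)%:E + e%:E * \int[dx]_(x in A) (fr x g)%:E.
  move=> mA.
  have frg x : (0 <= fr x g)%R by case/andP: (frf x g).
  have trg x : (0 <= tr x g)%R by case/andP: (trt x g).
  have mE (a : X -> R) : measurable_fun setT a ->
      measurable_fun A (fun x => (a x)%:E).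
    by move=> ma; apply/measurable_EFinP; exact: measurable_funTS.
  rewrite -!ge0_integralZl_EFin//; do ?[exact: mE|by move=> x _; rewrite lee_fin].
  rewrite -!ge0_integralD//;
    do ?[exact: mE|by apply: (mE (fun x => e * _ x _)%R); exact: measurable_funM
        |by move=> x _; rewrite lee_fin ?mulr_ge0].
  by apply: eq_integral => x _; rewrite -!EFinM -!EFinD /F; congr EFin; ring.
have sumD (a b : G -> \bar R) : \sum_g (a g + b g) = \sum_g a g + \sum_g b g.
  by rewrite big_split.
have F1 : \sum_g \int[dx]_x (F x g)%:E = 1.
  have : \sum_g (\int[dx]_x (F x g)%:E + e%:E * \int[dx]_x (tr x g)%:E) =
         \sum_g (\int[dx]_x (t x g)%:E + e%:E * \int[dx]_x (fr x g)%:E).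
    by apply: eq_bigr => g _; exact: FE.
  rewrite (sumD (fun g => \int[dx]_x (F x g)%:E)).
  rewrite (sumD (fun g => \int[dx]_x (t x g)%:E)).
  rewrite (density_mass t_density) -!ge0_sume_distrr; last 2 first.
  - by move=> g _; apply: integral_ge0 => x _; rewrite lee_fin; case/andP: (frf x g).
  - by move=> g _; apply: integral_ge0 => x _; rewrite lee_fin; case/andP: (trt x g).
  rewrite transfer_mass => /eqP; rewrite addeC [1 + _]addeC.
  have mfin : e%:E * (\sum_g \int[dx]_x (tr x g)%:E) \is a fin_num.
    by rewrite fin_numM// sum_fin_num; apply/allP => y /mapP[g _ ->]; exact: fin.
  move: mfin; case: (e%:E * _) => // m _.
  case: (\sum_g _) => [a| |] //.
  by rewrite -!EFinD eqe => /eqP/addrI ->.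
have [sigma dsigma] := probability_of_density mF F0 F1.
(* [F <= f + t]; this domination gives [sigma] a finite second moment. *)
have sigma_le A : measurable A -> sigma A <= measure_add mu mu_tau A.
  move=> mA; rewrite measure_addE dsigma.2//.
  rewrite [X in _ <= X + _](f_density.2 _ mA) [X in _ <= _ + X](t_density.2 _ mA).
  rewrite -(sumD (fun g => \int[dx]_(x in _) (f x g)%:E)).
  apply: lee_sum => g _; have mAg := measurable_section g mA.
  rewrite -ge0_integralD//;
    do ?[by move=> x _; rewrite lee_fin
        |by apply/measurable_EFinP; exact: measurable_funTS].
  apply: ge0_le_integral => //;
    do ?[by move=> x _; rewrite lee_fin|by move=> x _; rewrite -EFinD lee_fin addr_ge0
        |by apply/measurable_EFinP; apply: measurable_funTS
        |by apply: emeasurable_funD; apply/measurable_EFinP; exact: measurable_funTS].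
  move=> x _; rewrite -EFinD lee_fin /F.
  have /andP[tr0 _] := trt x g; have /andP[fr0 fr1] := frf x g.
  have := ler_piMl fr0 e1; have := mulr_ge0 e0 tr0; lra.
have mkh' g g' : measurable_fun setT (fun x => (1 - e * kap x g g') * h x g g')%R.
  apply: measurable_funM => //; apply: measurable_funB => //.
  exact: measurable_funM.
have ew01 g z : (0 <= e * w g z <= 1)%R.
  have /andP[w0 w1] := w01 g z.
  by rewrite mulr_ge0//= (le_trans (ler_piMr _ w1)).
have mew g : measurable_fun setT (fun z => e * w g z)%R by exact: measurable_funM.
have /choice[gam' gam'P] : forall g, exists gam' : {measure set (X * X) -> \bar R},
  [/\ forall A, measurable A -> gam' (fst @^-1` A) = gam g (fst @^-1` A),
      forall A, measurable A ->
        gam' (snd @^-1` A) + e%:E * \int[dx]_(x in A) (sr x g)%:E =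
        \int[dx]_(x in A) (inter x g)%:E + e%:E * \int[dx]_(x in A) (fr x g)%:E &
      \int[gam']_z (sqnorm (z.1 - z.2))%:E <=
       \int[gam g]_z (sqnorm (z.1 - z.2))%:E].
  move=> g; have [g1 [g1E g2E g3E]] := partial_return_plan (gam g) (mew g) (ew01 g).
  exists g1; split=> // A mA.
  have mB1 : measurable ((fst : X * X -> X) @^-1` A).
    by rewrite -[X in measurable X]setTI; exact: measurable_fst.
  have mB2 : measurable ((snd : X * X -> X) @^-1` A).
    by rewrite -[X in measurable X]setTI; exact: measurable_snd.
  rewrite -srE// -frE// -second_marginal// -!ge0_integralZl_EFin//;
    do ?[by move=> z _; rewrite lee_fin; case/andP: (w01 g z)
        |by apply/measurable_EFinP; exact: measurable_funTS].
  exact: g2E.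
pose h' x g g' := ((1 - e * kap x g g') * h x g g')%R.
have h'h x g g' : (h' x g g' ^+ 2 <= h x g g' ^+ 2)%R.
  have /andP[k0 k1] := (kap01 x g g').1.
  have ek : (e * kap x g g' <= 1)%R by rewrite (le_trans (ler_piMr _ k1)).
  have ek0 := mulr_ge0 e0 k0.
  rewrite /h' exprMn ler_piMl ?sqr_ge0// exprn_ile1//; lra.
have mE (k : X -> G -> G -> R) g g' : measurable_fun setT (fun x => k x g g') ->
    measurable_fun setT (fun x => (k x g g' ^+ 2 * K g g' * expR (- W x))%:E).
  move=> mk; apply/measurable_EFinP; apply: measurable_funM.
    by apply: measurable_funM => //; exact: measurable_funX.
  by apply: measurableT_comp => //; exact: measurable_funN.
have energy_le : flux_energy K W h' <= flux_energy K W h.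
  apply: lee_sum => g _; apply: lee_sum => g' _; apply: ge0_le_integral => //;
    do ?[exact: (mE h' _ _ (mkh' _ _))|exact: mE].
  - move=> x _; rewrite lee_fin mulr_ge0 ?expR_ge0//.
    by apply: mulr_ge0 => //; exact: sqr_ge0.
  - by move=> x _; rewrite lee_fin ler_wpM2r ?expR_ge0// ler_wpM2r.
exists sigma; split=> //.
  apply: (@le_lt_trans _ _
      (\int[measure_add mu mu_tau]_z (sqnorm z.1)%:E)).
    apply: ge0_le_measure_integral => //.
      by move=> z; rewrite lee_fin sumr_ge0// => i _; exact: sqr_ge0.
    apply/measurable_EFinP.
    exact: measurableT_comp (@measurable_sqnorm R d) measurable_fst.
  rewrite ge0_integral_measure_add//.
  - by rewrite lte_add_pinfty.
  - by move=> z _; rewrite lee_fin sumr_ge0// => i _; exact: sqr_ge0.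
  - apply/measurable_EFinP.
    exact: measurableT_comp (@measurable_sqnorm R d) measurable_fst.
apply: (@le_trans _ _ (cost K W tau gam' h')); last first.
  rewrite /cost; apply: leeD.
    apply: lee_sum => g _; apply: lee_pmul => //.
    - by rewrite lee_fin invr_ge0 mulr_ge0// ltW.
    - apply: integral_ge0 => z _; rewrite lee_fin sumr_ge0// => i _.
      exact: sqr_ge0.
    - by have [] := gam'P g.
  by apply: lee_wpmul2l => //; rewrite lee_fin divr_ge0// ltW.
apply: ereal_inf_lbound; exists gam', h'; split=> //; split.
- move=> g A mA; have [-> // _ _] := gam'P g.
  by have [+ _ _ _ _] := adm; exact.
- by move=> g g'; exact: mkh'.
- have [_ _ hN _ _] := adm.
  by move=> x g g'; rewrite /h' (hN x g g') (kap01 x g g').2 mulrN.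
- by apply: le_lt_trans energy_le _; case: adm.
move=> g A mA.
have J'E : {ae dx, forall x, (\sum_(g' : G) jump h' x g g' =
    \sum_(g' : G) jump h x g g' - e * sr x g + e * tr x g)%R}.
  apply: filterS (sr_tr g) => x E.
  rewrite -addrA -mulrN -mulrDr [(- _ + _)%R]addrC -opprB E mulrN.
  rewrite mulr_sumr -sumrB; apply: eq_bigr => g' _; rewrite /jump /h'; ring.
have mJ' : measurable_fun setT (fun x => \sum_(g' : G) jump h' x g g')%R.
  by apply: measurable_sum => g'; apply: measurable_jump; exact: mkh'.
have iR : dx.-integrable setT (fun x => (\sum_(g' : G) jump h x g g')%:E -
    e%:E * (sr x g)%:E + e%:E * (tr x g)%:E).
  apply: integrableD => //; last exact: (integrableZl measurableT e (itr g)).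
  apply: integrableB => //; last exact: (integrableZl measurableT e (isr g)).
  exact: iJ.
have J'E' : ae_eq dx setT (EFin \o (fun x => \sum_(g' : G) jump h' x g g')%R)
    (fun x => (\sum_(g' : G) jump h x g g')%:E -
    e%:E * (sr x g)%:E + e%:E * (tr x g)%:E).
  by apply: filterS J'E => x /= -> _; rewrite !EFinD EFinN !EFinM.
have iJ' : dx.-integrable setT (EFin \o (fun x => \sum_(g' : G) jump h' x g g')%R).
  apply/integrableP; split; first exact/measurable_EFinP.
  have /integrableP[mR] := iR; apply: le_lt_trans; rewrite le_eqVlt; apply/orP; left.
  apply/eqP; apply: ae_eq_integral => //.
  - by apply: measurableT_comp => //; exact/measurable_EFinP.
  - exact: measurableT_comp.
  - by apply: filterS J'E' => x E xT; exact: (congr1 abse (E xT)).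
rewrite integral_jump//; last by move=> g'; exact: mkh'.
have iS (a : X -> R) : dx.-integrable setT (EFin \o a) ->
    dx.-integrable A (fun x => (a x)%:E).
  exact: integrableS.
have iSe (a : X -> R) : dx.-integrable setT (EFin \o a) ->
    dx.-integrable A (fun x => e%:E * (a x)%:E).
  by move=> ia; apply: integrableZl => //; exact: iS.
have J'A : \int[dx]_(x in A) (\sum_(g' : G) jump h' x g g')%:E =
    \int[dx]_(x in A) (\sum_(g' : G) jump h x g g')%:E -
    e%:E * \int[dx]_(x in A) (sr x g)%:E + e%:E * \int[dx]_(x in A) (tr x g)%:E.
  rewrite -(integralZl mA (iS _ (isr g))) -(integralZl mA (iS _ (itr g))).
  rewrite -(integralB mA (iS _ (iJ g)) (iSe _ (isr g))).
  rewrite -(integralD mA _ (iSe _ (itr g))); last first.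
    apply: (integrableB mA _ (iSe _ (isr g))); exact: iS _ (iJ g).
  apply: ae_eq_integral => //.
  - by apply/measurable_EFinP; exact: measurable_funTS.
  - by apply: measurable_funTS; exact: measurable_int iR.
  - by apply: filterS J'E' => x E _; exact: E.
have interA : \int[dx]_(x in A) (inter x g)%:E =
    \int[dx]_(x in A) (t x g)%:E + \int[dx]_(x in A) (\sum_(g' : G) jump h x g g')%:E.
  by rewrite -(integralD mA (iS _ (it g)) (iS _ (iJ g))).
(* All integrals are finite, so the balances for [F], for [gam'] and for the jumps combine by linear
   arithmetic over the reals. *)
have [_ gam'A _] := gam'P g; have {gam'A} := gam'A _ mA.
have := FE g A mA; rewrite (componentE g dsigma)// J'A interA.
have := fin g A _ mA (it g); have := fin g A _ mA (ifr g).
have := fin g A _ mA (itr g); have := fin g A _ mA (isr g).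
have := fin g A (fun x g => \sum_(g' : G) jump h x g g')%R mA (iJ g).
case: (\int[dx]_(x in A) (\sum_(g' : G) jump h x g g')%:E) => // a1 _.
case: (\int[dx]_(x in A) (sr x g)%:E) => // a2 _.
case: (\int[dx]_(x in A) (tr x g)%:E) => // a3 _.
case: (\int[dx]_(x in A) (fr x g)%:E) => // a4 _.
case: (\int[dx]_(x in A) (t x g)%:E) => // a5 _.
case: (\int[dx]_(x in A) (F x g)%:E) => // a6.
rewrite -!EFinM -!EFinD => -[E1]; case: (gam' _ _) => // a7.
rewrite -!EFinD => -[E2]; congr EFin; lra.
Qed.

End transfer.

(* [fr] is the density of the sent-back particles at their starting points, [tr] the
   one at their end points. *)
Definition transferable (fr tr : X -> G -> R) :=
  [/\ forall g, measurable_fun setT (fr ^~ g),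
      forall g, measurable_fun setT (tr ^~ g),
      forall x g, (0 <= fr x g <= f x g)%R /\ (0 <= tr x g <= t x g)%R,
      \sum_g \int[dx]_x (fr x g)%:E = \sum_g \int[dx]_x (tr x g)%:E &
      forall e : R, (0 <= e <= 1)%R -> exists sigma,
      [/\ P2 sigma,
          is_density sigma (fun x g => t x g + e * (fr x g - tr x g))%R &
          static_cost K W tau mu sigma <= cost K W tau gam h]].

(* [inter >= 0] holds only almost everywhere; multiplying by [good] makes the
   flow balance exact at every point. *)
Definition good x : R := (\prod_(g : G) (0 <= inter x g)%R%:R)%R.

Let minter g : measurable_fun setT (inter ^~ g).
Proof.
apply: measurable_funD => //; apply: measurable_sum => g'.
exact: measurable_jump.
Qed.

Lemma measurable_good : measurable_fun setT good.
Proof.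
apply: measurable_prod => g _.
rewrite (_ : (fun x => _) = fun x => if (0 <= inter x g)%R then 1%R else 0%R).
  by apply: measurable_fun_ifT => //; exact: measurable_fun_ler.
by apply/funext => x; case: ifP.
Qed.

Lemma good01 x : (0 <= good x <= 1)%R.
Proof.
by apply/andP; split; [apply: prodr_ge0|apply: prodr_ile1] => g _;
  rewrite ?ler0n ?lern1 ?leq_b1.
Qed.

Lemma good_inter_ge0 x g : (0 <= good x * inter x g)%R.
Proof.
rewrite /good (bigD1 g)//= mulrAC mulr_ge0//; last by apply: prodr_ge0.
by case: (leP 0%R (inter x g)); rewrite ?mul1r ?mul0r.
Qed.

Lemma good_ae : {ae dx, forall x, good x = 1%R}.
Proof.
have h0 g : {ae dx, forall x, (0 <= inter x g)%R}.
  apply: (@ae_le_of_integral _ _ _ _ (cst 0%R)).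
  - exact: integrable0.
  - exact: inter_integrable.
  - move=> A mA; rewrite integral0 -second_marginal//; exact: measure_ge0.
apply: filterS (filter_forall _ h0) => x hx.
by rewrite /good big1// => g _; rewrite hx.
Qed.

(** * Selecting particles by starting point or by end point *)

Let gs x g := (good x * inter x g)%R.
Let gt x g := (good x * t x g)%R.
Let gq x g g' := (good x * jump h x g g')%R.

Let mgs g : measurable_fun setT (gs ^~ g).
Proof. by apply: measurable_funM => //; exact: measurable_good. Qed.
Let mgt g : measurable_fun setT (gt ^~ g).
Proof. by apply: measurable_funM => //; exact: measurable_good. Qed.
Let mgq g g' : measurable_fun setT (fun x => gq x g g').
Proof.
apply: measurable_funM; [exact: measurable_good|exact: measurable_jump].
Qed.

Let gt0 x g : (0 <= gt x g)%R.
Proof. by rewrite mulr_ge0//; case/andP: (good01 x). Qed.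

Let gtt x g : (gt x g <= t x g)%R.
Proof. by rewrite ler_piMl//; case/andP: (good01 x). Qed.

Let gqN x g g' : gq x g g' = (- gq x g' g)%R.
Proof. by rewrite /gq jump_anti mulrN. Qed.

Let gsE x g : (gs x g - gt x g = \sum_g' gq x g g')%R.
Proof. by rewrite /gs /gt /gq -mulr_sumr -mulrBr /inter addrC addKr. Qed.

Let gq_ae (kap : X -> G -> G -> R) (sr tr : X -> G -> R) :
  (forall x g, sr x g - tr x g = \sum_g' kap x g g' * gq x g g')%R ->
  forall g, {ae dx, forall x,
    (sr x g - tr x g = \sum_(g' : G) kap x g g' * jump h x g g')%R}.
Proof.
move=> E g; apply: filterS good_ae => x g1; rewrite E.
by apply: eq_bigr => g' _; rewrite /gq g1 mul1r.
Qed.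

Let gs_integral g A : measurable A ->
  gam g (snd @^-1` A) = \int[dx]_(x in A) (gs x g)%:E.
Proof.
move=> mA; rewrite second_marginal//; apply: ae_eq_integral => //.
- by apply/measurable_EFinP; exact: measurable_funTS.
- by apply/measurable_EFinP; exact: measurable_funTS.
- by apply: filterS good_ae => x g1 _ /=; rewrite /gs g1 mul1r.
Qed.

Let gs_integrable g : dx.-integrable setT (EFin \o (gs ^~ g)).
Proof.
apply: le_integrable (inter_integrable g) => //; first exact/measurable_EFinP.
move=> x _ /=; rewrite lee_fin normrM; have /andP[g0 g1] := good01 x.
by rewrite ler_piMl// ger0_norm.
Qed.

Let first_marginal g A : measurable A ->
  gam g (fst @^-1` A) = \int[dx]_(x in A) (f x g)%:E.
Proof.
by move=> mA; rewrite -(componentE g f_density)//; have [+ _ _ _ _] := adm; exact.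
Qed.

(** The weight depends on the starting point only, so [fr] is explicit; domination gives the density
    [sr] after the move, and the forward colouring gives [tr]. *)
Lemma transfer_from (A : X -> G -> bool) :
  (forall g, measurable_fun setT (A ^~ g)) ->
  exists tr, transferable (fun x g => if A x g then f x g else 0%R) tr.
Proof.
move=> mA.
have mA1 g : measurable_fun setT (fun x => (A x g)%:R : R).
  rewrite (_ : (fun x => _) = fun x => if A x g then 1%R else 0%R).
    exact: measurable_fun_ifT.
  by apply/funext => x; case: ifP.
have mw g : measurable_fun setT (fun z : X * X => (A z.1 g)%:R : R).
  exact: measurableT_comp (mA1 g) measurable_fst.
have w01 g (z : X * X) : (0 <= ((A z.1 g)%:R : R) <= 1)%R.
  by rewrite ler0n lern1 leq_b1.
have /choice[r rP] := fun g => dominated_marginal (@measurable_snd _ _ X X)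
  (gs_integrable g) (@gs_integral g) (mw g) (w01 g) (good_inter_ge0 ^~ g).
pose sr x g := r g x.
have msr g : measurable_fun setT (sr ^~ g) by have [] := rP g.
have srs x g : (0 <= sr x g <= gs x g)%R by have [_ + _] := rP g; exact.
have srE g B : measurable B ->
    \int[gam g]_(z in snd @^-1` B) ((A z.1 g)%:R)%:E = \int[dx]_(x in B) (sr x g)%:E.
  by have [_ _] := rP g; exact.
have [kap [tr [mkap mtr kap01 trt sr_tr]]] :=
  flow_forward mgs mgt msr mgq srs gt0 gqN gsE.
have mfr g : measurable_fun setT (fun x => if A x g then f x g else 0%R).
  exact: measurable_fun_ifT.
have frf x g : (0 <= (if A x g then f x g else 0) <= f x g)%R.
  by case: ifP; rewrite f_ge0 lexx.
have frE g B : measurable B -> \int[gam g]_(z in fst @^-1` B) ((A z.1 g)%:R)%:E =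
    \int[dx]_(x in B) (if A x g then f x g else 0)%:E.
  move=> mB; rewrite (integral_marginal (@measurable_fst _ _ X X)
    (density_integrable g f_density) (@first_marginal g) (mA1 g))//.
  by apply: eq_integral => x _; case: ifP; rewrite ?mul1r ?mul0r.
have trt' x g : (0 <= tr x g <= t x g)%R.
  by have /andP[-> /le_trans -> //] := trt x g.
have sr0 x g : (0 <= sr x g)%R by case/andP: (srs x g).
exists tr; split=> //.
- by apply: (transfer_mass (w := fun g z => (A z.1 g)%:R) (sr := sr) (kap := kap)) => //;
    exact: gq_ae.
- move=> e e01.
  by apply: (transfer_competitor (w := fun g z => (A z.1 g)%:R) (sr := sr) (kap := kap))
    => //; exact: gq_ae.
Qed.

(** The end points are prescribed and the past is reconstructed: the backward colouring gives the
    density [sr], before the jumps, of the mass that ends in [A]; particles moved to [x] are then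
    weighted by the proportion [v = sr / gs] there, wherever they started. The factor [good] is why
    [tr] is known only almost everywhere. *)
Lemma transfer_into (A : X -> G -> bool) :
  (forall g, measurable_fun setT (A ^~ g)) ->
  exists fr, exists2 tr, transferable fr tr &
    forall g, {ae dx, forall x, tr x g = if A x g then t x g else 0%R}.
Proof.
move=> mA.
pose tr x g := (if A x g then gt x g else 0)%R.
have mtr g : measurable_fun setT (tr ^~ g) by exact: measurable_fun_ifT.
have trt x g : (0 <= tr x g <= gt x g)%R.
  by rewrite /tr; case: ifP; rewrite gt0 lexx.
have [kap [sr [mkap msr kap01 srs sr_tr]]] :=
  flow_backward mgs mgt mtr mgq trt good_inter_ge0 gqN gsE.
(* Where [gs] vanishes so does [sr], and the quotient is [0]. *)
pose v x g := (sr x g / gs x g)%R.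
have mv g : measurable_fun setT (v ^~ g).
  apply: measurable_funM => //; apply: measurable_fun_inv_ge0 => // x.
  exact: good_inter_ge0.
have v01 x g : (0 <= v x g <= 1)%R.
  have /andP[sr0 sr1] := srs x g.
  rewrite divr_ge0 ?good_inter_ge0//=.
  have := good_inter_ge0 x g; rewrite le_eqVlt => /predU1P[s0|s0].
    by rewrite /v /gs -s0 invr0 mulr0.
  by rewrite ler_pdivrMr// mul1r.
have mw g : measurable_fun setT (fun z : X * X => v z.2 g).
  exact: measurableT_comp (mv g) measurable_snd.
have /choice[r rP] := fun g => dominated_marginal (@measurable_fst _ _ X X)
  (density_integrable g f_density) (@first_marginal g) (mw g)
  (fun z => v01 z.2 g) (f_ge0 ^~ g).
pose fr x g := r g x.
have mfr g : measurable_fun setT (fr ^~ g) by have [] := rP g.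
have frf x g : (0 <= fr x g <= f x g)%R by have [_ + _] := rP g; exact.
have frE g B : measurable B ->
    \int[gam g]_(z in fst @^-1` B) (v z.2 g)%:E = \int[dx]_(x in B) (fr x g)%:E.
  by have [_ _] := rP g; exact.
have srE g B : measurable B ->
    \int[gam g]_(z in snd @^-1` B) (v z.2 g)%:E = \int[dx]_(x in B) (sr x g)%:E.
  move=> mB; rewrite (integral_marginal (@measurable_snd _ _ X X)
    (gs_integrable g) (@gs_integral g) (mv g))//; last first.
    by move=> x; case/andP: (v01 x g).
  apply: eq_integral => x _; congr EFin; rewrite /v.
  have [s0|s0] := eqVneq (gs x g) 0%R; last by rewrite divfK.
  by have := srs x g; rewrite s0 -eq_le mulr0 => /eqP.
have sr0 x g : (0 <= sr x g)%R by case/andP: (srs x g).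
have trt' x g : (0 <= tr x g <= t x g)%R.
  by have /andP[-> /le_trans -> //] := trt x g.
have w01 g (z : X * X) : (0 <= v z.2 g <= 1)%R by exact: v01.
exists fr, tr.
  split=> //.
  - by apply: (transfer_mass (w := fun g z => v z.2 g) (sr := sr) (kap := kap)) => //;
      exact: gq_ae.
  - move=> e e01.
    by apply: (transfer_competitor (w := fun g z => v z.2 g) (sr := sr) (kap := kap))
      => //; exact: gq_ae.
move=> g; apply: filterS good_ae => x g1.
by rewrite /tr /gt g1 mul1r.
Qed.

End competitor.

(** * Minimality *)

Lemma ae_le_integral d (T : measurableType d) (R : realType)
    (m : {measure set T -> \bar R}) (a b : T -> R) :
  measurable_fun setT a -> measurable_fun setT b ->
  {ae m, forall x, a x <= b x} ->
  (\int[m]_x (a x)%:E <= \int[m]_x (b x)%:E)%E.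
Proof.
move=> ma mb ab; rewrite integralE [leRHS]integralE; apply: leeB.
  apply: ae_ge0_le_integral => //.
  - by apply: measurable_funepos; exact/measurable_EFinP.
  - by apply: measurable_funepos; exact/measurable_EFinP.
  - apply: filterS ab => x abx _; rewrite !funeposE ge_max le_max lee_fin abx/=.
    by rewrite le_max lexx orbT.
apply: ae_ge0_le_integral => //.
- by apply: measurable_funeneg; exact/measurable_EFinP.
- by apply: measurable_funeneg; exact/measurable_EFinP.
- apply: filterS ab => x abx _; rewrite !funenegE ge_max le_max leeN2 lee_fin abx/=.
  by rewrite le_max lexx orbT.
Qed.

Section minimizer.
Context (R : realType) (d : nat) (G : finPointedType).
Local Notation X := ('rV[R]_d).
Local Notation dx := (lebesgue_rV R d).
Local Open Scope ereal_scope.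
Variables (K : G -> G -> R) (W : X -> R) (tau : R) (V : X -> G -> R).
Hypotheses (K_ge0 : forall g g', (0 <= K g g')%R) (tau_gt0 : (0 < tau)%R)
  (mV : forall g, measurable_fun setT (V ^~ g)).
Implicit Types (mu sigma : probability (X * discrete G)%type R).

Lemma measurable_ent (f : X -> G -> R) g : measurable_fun setT (f ^~ g) ->
  measurable_fun setT (fun x => ent (V x g) (f x g)).
Proof.
move=> mf; apply: measurable_funD; last exact: measurable_funM.
by apply: measurable_funM => //; exact: measurableT_comp (@measurable_ln R) mf.
Qed.

Lemma entropyE mu f : is_density mu f ->
  entropy V mu = \sum_g \int[dx]_x (ent (V x g) (f x g))%:E.
Proof.
move=> df; rewrite /entropy.
rewrite (_ : [set _ | _ in _] =
  [set \sum_g \int[dx]_x (ent (V x g) (f x g))%:E]) ?ereal_inf1//.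
have E f' : is_density mu f' ->
    \sum_(g : G) \int[dx]_x (f' x g * ln (f' x g) + V x g * f' x g)%:E =
    \sum_g \int[dx]_x (ent (V x g) (f x g))%:E.
  move=> df'; apply: eq_bigr => g _; apply: ae_eq_integral => //.
  - by apply/measurable_EFinP; apply: measurable_ent; exact: df'.1.
  - by apply/measurable_EFinP; apply: measurable_ent; exact: df.1.
  - by apply: filterS (density_unique g df df') => x E _; rewrite /ent E.
apply/seteqP; split=> [_ [f' df' <-]|_ ->]; first exact: E.
by exists f => //; exact: E.
Qed.

Lemma flux_energy_ge0 h : 0 <= flux_energy K W h.
Proof.
apply: sume_ge0 => g _; apply: sume_ge0 => g' _; apply: integral_ge0 => x _.
by rewrite lee_fin mulr_ge0 ?expR_ge0// mulr_ge0// sqr_ge0.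
Qed.

Lemma static_cost_ge0 mu sigma : 0 <= static_cost K W tau mu sigma.
Proof.
apply: le_ereal_inf_tmp => _ [gam [h [_ ->]]]; apply: adde_ge0.
  apply: sume_ge0 => g _; apply: mule_ge0.
    by rewrite lee_fin invr_ge0 mulr_ge0// ltW.
  apply: integral_ge0 => z _; rewrite lee_fin sumr_ge0// => i _; exact: sqr_ge0.
by rewrite mule_ge0 ?flux_energy_ge0// lee_fin divr_ge0// ltW.
Qed.

(** Every particle stays in place and there is no flux. This makes [mu] a competitor of value at
    most [entropy V mu]. *)
Lemma static_cost_refl mu f : is_density mu f -> (forall x g, 0 <= f x g)%R ->
  static_cost K W tau mu mu <= 0.
Proof.
move=> df f0.
pose diag (x : X) := (x, x).
have mdiag : measurable_fun setT diag by exact: measurable_fun_pair.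
have /choice[gam gamE] : forall g, exists gam : {measure set (X * X) -> \bar R},
    (forall A, measurable A -> gam A = \int[dx]_(x in diag @^-1` A) (f x g)%:E) /\
    \int[gam]_z (sqnorm (z.1 - z.2))%:E = 0.
  move=> g; have [nu nuE] := measure_of_density dx (df.1 g) (f0 ^~ g).
  unshelve epose (gam := (pushforward nu diag : {measure set (X * X) -> \bar R})).
    exact: mdiag.
  exists gam; split=> [A _|]; first by rewrite -nuE.
  rewrite (ge0_integral_pushforward mdiag)//.
  - rewrite integral0_eq// => z _ /=; rewrite subrr /sqnorm big1// => i _.
    by rewrite mxE expr0n.
  - apply/measurable_EFinP; apply: measurable_sum => i; apply: measurable_funX.
    under eq_fun do rewrite !mxE.
    apply: measurable_funB.
      exact: measurableT_comp (measurable_coord i) measurable_fst.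
    exact: measurableT_comp (measurable_coord i) measurable_snd.
  - by move=> z _; rewrite lee_fin sumr_ge0// => i _; exact: sqr_ge0.
have mfst A : measurable A -> measurable ((fst : X * X -> X) @^-1` A).
  by move=> mA; rewrite -[X in measurable X]setTI; exact: measurable_fst.
have msnd A : measurable A -> measurable ((snd : X * X -> X) @^-1` A).
  by move=> mA; rewrite -[X in measurable X]setTI; exact: measurable_snd.
have energy0 : flux_energy K W (fun (_ : X) (_ _ : G) => 0%R) = 0.
  rewrite /flux_energy big1// => g _; rewrite big1// => g' _.
  by rewrite integral0_eq// => x _; rewrite expr0n/= !mul0r.
apply: ereal_inf_lbound; exists gam, (fun (_ : X) (_ _ : G) => 0%R); split.
  split=> //.
  - by move=> g A mA; rewrite (gamE g).1 ?(componentE g df)//; exact: mfst.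
  - by move=> x g g'; rewrite oppr0.
  - by rewrite energy0.
  - move=> g A mA; rewrite (gamE g).1 ?(componentE g df)//; last exact: msnd.
    rewrite [X in _ - tau%:E * X]integral0_eq ?mule0 ?sube0//.
    by move=> x _; rewrite big1// => g' _; rewrite !mul0r.
rewrite /cost energy0 mule0 adde0 big1// => g _.
by rewrite (gamE g).2 mule0.
Qed.

(** Suppose that the total integral [c] of [D] is positive. The term in [a] integrates to zero by
    conservation of mass, the second-order term gives [2 * e^2 * B] since [f] and [t] have mass [1],
    and a near-optimal plan loses less than [e * c / 4]. For small [e] the losses stay below the
    gain [e * c], against minimality. [D] is quantified before the plan because [e] must be fixed
    before the plan is chosen. *)
Lemma no_improvement mu mu_tau (f t D : X -> G -> R) (lam a B : R) :
  (forall x g, 0 <= f x g)%R -> (forall x g, 0 <= t x g)%R ->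
  is_density mu f -> is_density mu_tau t -> (0 < lam)%R ->
  (forall g, {ae dx, forall x, (lam * expR (- V x g) <= f x g)%R}) ->
  entropy V mu < +oo -> P2 mu ->
  (forall sigma, P2 sigma ->
     entropy V mu_tau + static_cost K W tau mu mu_tau <=
     entropy V sigma + static_cost K W tau mu sigma) ->
  (forall g, measurable_fun setT (D ^~ g)) ->
  (forall x g, 0 <= D x g)%R -> (0 <= B)%R ->
  (forall g, {ae dx, forall x, (D x g <= f x g + t x g)%R}) ->
  (forall gam h, admissible K W tau mu mu_tau gam h ->
    exists fr, exists2 tr, transferable K W tau mu f t gam h fr tr &
    forall e, (0 < e <= 2^-1)%R -> forall g, {ae dx, forall x,
      (ent (V x g) (t x g + e * (fr x g - tr x g)) <=
       ent (V x g) (t x g) +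
       e * (a * (fr x g - tr x g) + e * (B * (f x g + t x g)) - D x g))%R}) ->
  forall g, {ae dx, forall x, D x g = 0%R}.
Proof.
move=> f0 t0 df dt lam0 fV Emu P2mu min mD D0 B0 Dft imp.
have integrable_add (u v : X -> R) : dx.-integrable setT (EFin \o u) ->
    dx.-integrable setT (EFin \o v) ->
    dx.-integrable setT (EFin \o (fun x => u x + v x)%R).
  by move=> iu iv; exact: (integrableD measurableT iu iv).
have integrable_scale (c : R) (u : X -> R) : dx.-integrable setT (EFin \o u) ->
    dx.-integrable setT (EFin \o (fun x => c * u x)%R).
  by move=> iu; exact: (integrableZl measurableT c iu).
have if_ g := density_integrable g df.
have it g := density_integrable g dt.
have iD g : dx.-integrable setT (EFin \o (D ^~ g)).
  apply/integrableP; split; first exact/measurable_EFinP.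
  have := integrable_lty measurableT (integrable_add _ _ (if_ g) (it g)).
  apply: le_lt_trans; apply: ae_ge0_le_integral => //.
  - by apply: measurableT_comp => //; exact/measurable_EFinP.
  - by move=> x _; rewrite lee_fin addr_ge0.
  - exact: measurable_int (integrable_add _ _ (if_ g) (it g)).
  - by apply: filterS (Dft g) => x Dx _ /=; rewrite lee_fin ger0_norm.
have ment g := measurable_ent (dt.1 g).
(* By [ent_ge] and the lower bound on [f], the integrand is at least [- f / lam], which is
   integrable. *)
have ent_low g : -oo < \int[dx]_x (ent (V x g) (t x g))%:E.
  have il := integrable_scale (- lam^-1)%R _ (if_ g).
  apply: (@lt_le_trans _ _ (\int[dx]_x (- lam^-1 * f x g)%:E)).
    by rewrite ltNye_eq (integrable_fin_num measurableT il).
  apply: ae_le_integral => //; first by apply/measurable_EFinP; exact: measurable_int il.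
  apply: filterS (fV g) => x fx; apply: le_trans (ent_ge _ (t0 x g)).
  by rewrite mulNr lerN2 mulrC ler_pdivlMr// mulrC.
have S0 := static_cost_ge0 mu mu_tau.
(* Finiteness from above comes from minimality against [mu] itself. *)
have sumE : \sum_g \int[dx]_x (ent (V x g) (t x g))%:E < +oo.
  rewrite -(entropyE dt) ltNge leye_eq; apply/negP => /eqP Eoo.
  have := min mu P2mu; rewrite Eoo addye; last first.
    by rewrite gt_eqF// (lt_le_trans _ S0).
  rewrite leye_eq => /eqP; apply/eqP; rewrite -ltey.
  apply: (@le_lt_trans _ _ (entropy V mu)) => //.
  rewrite -[leRHS]adde0; apply: leeD => //; exact: static_cost_refl df f0.
have ient g : dx.-integrable setT (EFin \o (fun x => ent (V x g) (t x g))).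
  apply/integrableP; split; first exact/measurable_EFinP.
  rewrite integral_fin_num_abs// fin_numElt ent_low/=.
  rewrite ltNge leye_eq; apply/negP => /eqP goo; move: sumE.
  rewrite (bigD1 g)//= goo addye//.
  by apply/eqP => /esum_eqNyP[g' [_ _ E]]; have := ent_low g'; rewrite E.
have REE (u : X -> G -> R) : (forall g, dx.-integrable setT (EFin \o (u ^~ g))) ->
    \sum_g \int[dx]_x (u x g)%:E = (\sum_g \int[dx]_x u x g)%R%:E.
  move=> iu; rewrite -sumEFin; apply: eq_bigr => g _.
  by rewrite fineK// (integrable_fin_num measurableT (iu g)).
have EE : entropy V mu_tau = (\sum_g \int[dx]_x ent (V x g) (t x g))%R%:E.
  by rewrite (entropyE dt) REE.
have SE : static_cost K W tau mu mu_tau \is a fin_num.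
  rewrite ge0_fin_numE// ltNge leye_eq; apply/negP => /eqP Soo.
  have := min mu P2mu; rewrite EE Soo addey// leye_eq => /eqP; apply/eqP.
  rewrite -ltey; apply: (@le_lt_trans _ _ (entropy V mu)) => //.
  rewrite -[leRHS]adde0; apply: leeD => //; exact: static_cost_refl df f0.
pose c := (\sum_g \int[dx]_x D x g)%R.
have cg0 g : (0 <= \int[dx]_x D x g)%R by apply: Rintegral_ge0.
have c0 : (0 <= c)%R by apply: sumr_ge0.
move: c0; rewrite le_eqVlt => /predU1P[c0|c0].
  move=> g; have : (\int[dx]_x D x g == 0)%R.
    by have := c0 => /esym/eqP; rewrite psumr_eq0// => /allP/(_ g (mem_index_enum _)).
  move=> /eqP Dg0.
  have : \int[dx]_x `|(D x g)%:E| = 0.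
    rewrite (eq_integral (fun x => (D x g)%:E)); last first.
      by move=> x _; rewrite gee0_abs ?lee_fin.
    rewrite -[LHS]fineK; first by rewrite -[fine _]/(\int[dx]_x D x g)%R Dg0.
    exact: (integrable_fin_num measurableT (iD g)).
  move=> /(ae_eq_integral_abs _ measurableT).
  move=> /(_ ltac:(exact/measurable_EFinP)).
  by apply: filterS => x /= /(_ I) [].
(* The [8] keeps the second-order term [2 * e^2 * B] below [e * c / 4], [B + 1] avoids a division by
   [0], and [2^-1] is the range of the pointwise estimates. *)
pose e := Num.min 2^-1%R (c / (8 * (B + 1)))%R.
have e0 : (0 < e)%R by rewrite lt_min invr_gt0 ltr0n/= divr_gt0// mulr_gt0//; lra.
have e2 : (e <= 2^-1)%R by rewrite ge_min lexx.
have eB : (8 * (e * B) <= c)%R.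
  have : (e <= c / (8 * (B + 1)))%R by rewrite ge_min lexx orbT.
  rewrite ler_pdivlMr; last by apply: mulr_gt0 => //; lra.
  by have := e0; lra.
have eta0 : (0 < e * c / 4)%R by rewrite divr_gt0// mulr_gt0.
have [_ [gam [h [adm ->]]] lt_cost] := lb_ereal_inf_adherent eta0 SE.
rewrite -/(static_cost K W tau mu mu_tau) in lt_cost.
have [fr [tr tra small]] := imp gam h adm.
have [mfr mtr frtr frtrE comp] := tra.
have [|sigma [P2s ds cs]] := comp e; first by rewrite ltW//=; lra.
have ifr g : dx.-integrable setT (EFin \o (fr ^~ g)).
  apply: le_integrable (if_ g) => //; first exact/measurable_EFinP.
  move=> x _ /=; have [/andP[u0 u1] _] := frtr x g.
  by rewrite lee_fin !ger0_norm// (le_trans u0).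
have itr g : dx.-integrable setT (EFin \o (tr ^~ g)).
  apply: le_integrable (it g) => //; first exact/measurable_EFinP.
  move=> x _ /=; have [_ /andP[u0 u1]] := frtr x g.
  by rewrite lee_fin !ger0_norm// (le_trans u0).
(* The pointwise bound, arranged as sums and scalar multiples so that its integral splits term by
   term. *)
pose rhs x g := (ent (V x g) (t x g) + (e * a * (fr x g + (-1) * tr x g) +
  (e * (e * B) * (f x g + t x g) + (- e) * D x g)))%R.
have i1 g := integrable_add _ _ (ifr g) (integrable_scale (-1)%R _ (itr g)).
have i2 g := integrable_add _ _ (if_ g) (it g).
have i3 g := integrable_add _ _ (integrable_scale (e * (e * B))%R _ (i2 g))
  (integrable_scale (- e)%R _ (iD g)).
have i4 g := integrable_add _ _ (integrable_scale (e * a)%R _ (i1 g)) (i3 g).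
have irhs g : dx.-integrable setT (EFin \o (rhs ^~ g)).
  exact: integrable_add _ _ (ient g) (i4 g).
have rhsE g : (\int[dx]_x rhs x g = \int[dx]_x ent (V x g) (t x g) +
    (e * a * (\int[dx]_x fr x g + (-1) * \int[dx]_x tr x g) +
    (e * (e * B) * (\int[dx]_x f x g + \int[dx]_x t x g) +
     (- e) * \int[dx]_x D x g)))%R.
  rewrite (RintegralD measurableT (ient g) (i4 g)).
  rewrite (RintegralD measurableT (integrable_scale (e * a)%R _ (i1 g)) (i3 g)).
  rewrite (RintegralZl _ measurableT (i1 g)).
  rewrite (RintegralD measurableT (ifr g) (integrable_scale (-1)%R _ (itr g))).
  rewrite (RintegralZl _ measurableT (itr g)).
  rewrite (RintegralD measurableT (integrable_scale (e * (e * B))%R _ (i2 g))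
    (integrable_scale (- e)%R _ (iD g))).
  rewrite (RintegralZl _ measurableT (i2 g)) (RintegralZl _ measurableT (iD g)).
  by rewrite (RintegralD measurableT (if_ g) (it g)).
have Es : entropy V sigma <= (\sum_g \int[dx]_x rhs x g)%R%:E.
  rewrite -REE// (entropyE ds); apply: lee_sum => g _; apply: ae_le_integral.
  - exact: (measurable_ent (ds.1 g)).
  - by apply/measurable_EFinP; exact: measurable_int (irhs g).
  - have small' : (0 < e <= 2^-1)%R by rewrite e0.
    by apply: filterS (small e small' g) => x /le_trans; apply; rewrite /rhs; lra.
have := min sigma P2s; rewrite EE.
have mass (u : X -> G -> R) nu : is_density nu u -> (\sum_g \int[dx]_x u x g = 1)%R.
  move=> du; have := density_mass du; rewrite REE; first by case.
  by move=> g; exact: density_integrable du.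
have frtrR : (\sum_g \int[dx]_x fr x g = \sum_g \int[dx]_x tr x g)%R.
  by move: frtrE; rewrite !REE// => -[].
move=> ge; exfalso; move: ge; apply/negP; rewrite -ltNge.
apply: le_lt_trans (leeD Es (le_trans cs (ltW lt_cost))) _.
rewrite (eq_bigr _ (fun g _ => rhsE g)) !big_split/= -!mulr_sumr !big_split/= -!mulr_sumr.
rewrite (mass _ _ df) (mass _ _ dt) frtrR -/c.
rewrite -(fineK SE) -!EFinD lte_fin; have := mulr_gt0 e0 c0.
have := ler_wpM2l (ltW e0) eB; lra.
Qed.

End minimizer.

Theorem proposition5p3 (R : realType) (d : nat) (G : finPointedType)
    (K : G -> G -> R)
    (K_ge0 : forall g g', 0 <= K g g')
    (K_sym : forall g g', K g g' = K g' g)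
    (K_connected : forall g g', connect [rel a b | 0 < K a b] g g')
    (tau : R) (tau_gt0 : 0 < tau)
    (V : 'rV[R]_d -> G -> R)
    (V_diff : forall x g, differentiable (V ^~ g) x)
    (W : 'rV[R]_d -> R)
    (W_sobolev : W12_loc W)
    (W_moment :
      (\int[lebesgue_rV R d]_x (sqnorm x * expR (- W x))%:E < +oo)%E)
    (mu mu_tau : probability ('rV[R]_d * discrete G)%type R)
    (mu_P2 : P2 mu)
    (mu_entropy : (entropy V mu < +oo)%E)
    (mu_tau_P2 : P2 mu_tau)
    (mu_tau_min : forall sigma : probability ('rV[R]_d * discrete G)%type R,
      P2 sigma ->
      (entropy V mu_tau + static_cost K W tau mu mu_tau <=
       entropy V sigma + static_cost K W tau mu sigma)%E)
    (f f_tau : 'rV[R]_d -> G -> R)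
    (f_density : is_density mu f)
    (f_tau_density : is_density mu_tau f_tau)
    (lambda Lambda : R) (lambda_gt0 : 0 < lambda) (Lambda_gt0 : 0 < Lambda)
    (f_bounds : forall g, {ae lebesgue_rV R d, forall x,
      lambda * expR (- V x g) <= f x g <= Lambda * expR (- V x g)}) :
  forall g, {ae lebesgue_rV R d, forall x,
    lambda * expR (- V x g) <= f_tau x g <= Lambda * expR (- V x g)}.
Proof.
have mW : measurable_fun setT W by exact: W_sobolev.1.1.
have mV g : measurable_fun setT (V ^~ g).
  by apply: continuous_measurable_rV => x; exact/differentiable_continuous/V_diff.
have mE (l : R) g : measurable_fun setT (fun x => l * expR (- V x g)).
  apply: measurable_funM => //; apply: measurableT_comp => //.
  exact: measurable_funN.
(* The given densities are nonnegative only almost everywhere; their positive parts [u] and [t] are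
   densities of the same measures and are nonnegative at every point, as the transfers require. *)
have E0 (l : R) x g : 0 < l -> 0 < l * expR (- V x g).
  by move=> l0; rewrite mulr_gt0// expR_gt0.
pose u x g := Num.max (f x g) 0; pose t x g := Num.max (f_tau x g) 0.
have du : is_density mu u := density_funrpos f_density.
have dt : is_density mu_tau t := density_funrpos f_tau_density.
have u0 x g : 0 <= u x g by rewrite le_max lexx orbT.
have t0 x g : 0 <= t x g by rewrite le_max lexx orbT.
have tE g : {ae lebesgue_rV R d, forall x, t x g = f_tau x g}.
  by apply: filterS (density_ge0 g f_tau_density) => x x0; rewrite /t max_l.
have u_bounds g : {ae lebesgue_rV R d, forall x,
    lambda * expR (- V x g) <= u x g <= Lambda * expR (- V x g)}.
  apply: filterS (f_bounds g) => x /andP[h1 h2].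
  by rewrite /u max_l ?h1// (le_trans _ h1)// ltW// E0.
have u_ge g : {ae lebesgue_rV R d, forall x, lambda * expR (- V x g) <= u x g}.
  by apply: filterS (u_bounds g) => x /andP[].
have mu_ g := du.1 g; have mt g := dt.1 g.
have below : forall g, {ae lebesgue_rV R d, forall x,
    (if t x g < lambda * expR (- V x g) then (lambda * expR (- V x g) - t x g) *
      (1 - t x g / (lambda * expR (- V x g))) else 0) = 0}.
  apply: (no_improvement K_ge0 tau_gt0 mV (a := ln lambda + 1)
      (B := 2 + Lambda / lambda) u0 t0 du dt lambda_gt0 u_ge mu_entropy mu_P2
      mu_tau_min).
  - move=> g; apply: measurable_fun_ifT => //; first exact: measurable_fun_ltr.
    apply: measurable_funM; first exact: measurable_funB.
    apply: measurable_funB => //; apply: measurable_funM => //.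
    by apply: measurable_fun_inv_ge0 => // x; rewrite ltW// E0.
  - move=> x g; case: ltP => // tE'; rewrite mulr_ge0 ?subr_ge0 ?(ltW tE')//.
    by rewrite ler_pdivrMr ?E0// mul1r ltW.
  - by rewrite addr_ge0// divr_ge0// ltW.
  - move=> g; apply: filterS (u_ge g) => x ux; case: ltP => tE'; last first.
      by rewrite addr_ge0.
    apply: (@le_trans _ _ (lambda * expR (- V x g) - t x g)).
      rewrite ler_piMr ?subr_ge0 ?(ltW tE')// gerBl.
      by rewrite divr_ge0// ltW// E0.
    by have := t0 x g; lra.
  - move=> gam h adm.
    have [|tr tra] := transfer_from K_ge0 K_sym tau_gt0 mW mu_P2 mu_tau_P2 u0 t0
      du dt adm (A := fun x g => t x g < lambda * expR (- V x g)).
      by move=> g; exact: measurable_fun_ltr.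
    eexists; exists tr; first exact: tra.
    move=> e /andP[e0 e2] g; apply: filterS (u_bounds g) => x ub.
    apply: ent_move_below => //; first by rewrite ltW.
    by have [_ _ /(_ x g)[]] := tra.
(* [lambda] enters the upper bound too: the lower bound on [u] controls the negative part of the
   entropy. *)
have above : forall g, {ae lebesgue_rV R d, forall x,
    (if Lambda * expR (- V x g) < t x g then (t x g - Lambda * expR (- V x g)) *
      (1 - Lambda * expR (- V x g) / t x g) else 0) = 0}.
  apply: (no_improvement K_ge0 tau_gt0 mV (a := ln Lambda + 1)
      (B := 2) u0 t0 du dt lambda_gt0 u_ge mu_entropy mu_P2 mu_tau_min).
  - move=> g; apply: measurable_fun_ifT => //; first exact: measurable_fun_ltr.
    apply: measurable_funM; first exact: measurable_funB.
    apply: measurable_funB => //; apply: measurable_funM => //.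
    exact: measurable_fun_inv_ge0.
  - move=> x g; case: ltP => // Et; rewrite mulr_ge0 ?subr_ge0 ?(ltW Et)//.
    by rewrite ler_pdivrMr ?mul1r ?(ltW Et)// (lt_trans _ Et)// E0.
  - by [].
  - move=> g; apply: aeW => x; case: ltP => Et; last by rewrite addr_ge0.
    apply: (@le_trans _ _ (t x g - Lambda * expR (- V x g))).
      rewrite ler_piMr ?subr_ge0 ?(ltW Et)// gerBl.
      by rewrite divr_ge0// ltW// E0.
    by have := u0 x g; have := E0 Lambda x g Lambda_gt0; lra.
  - move=> gam h adm.
    have [|fr [tr tra trE]] := transfer_into K_ge0 K_sym tau_gt0 mW mu_P2
      mu_tau_P2 u0 t0 du dt adm (A := fun x g => Lambda * expR (- V x g) < t x g).
      by move=> g; exact: measurable_fun_ltr.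
    exists fr, tr => // e /andP[e0 e2] g.
    apply: filterS2 (u_bounds g) (trE g) => x /andP[_ ub] ->.
    apply: ent_move_above => //; first by rewrite ltW.
    by have [_ _ /(_ x g)[]] := tra.
(* Where a bound fails, both factors of the corresponding [D] are positive, so the vanishing of [D]
   excludes such points. *)
move=> g; apply: filterS3 (below g) (above g) (tE g) => x + + <-.
case: ltP => [tl|_].
  move=> /eqP; rewrite mulf_eq0 !subr_eq0 => /orP[/eqP E|/eqP E].
    by move: tl; rewrite E ltxx.
  have E1 := lt0r_neq0 (E0 lambda x g lambda_gt0).
  by move: tl; rewrite -[ltLHS](divfK E1) -E mul1r ltxx.
move=> _; case: ltP => [tl|//].
have tx0 : 0 < t x g by rewrite (lt_trans _ tl)// E0.
move=> /eqP; rewrite mulf_eq0 !subr_eq0 => /orP[/eqP E|/eqP E].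
  by move: tl; rewrite E ltxx.
by move: tl; rewrite -[ltLHS](divfK (lt0r_neq0 tx0)) -E mul1r ltxx.
Qed.
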